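(* Let $K\subseteq\mathbb{R}^n$ be a convex body such that $0\in K$. For any $0<p<q$ we have $$\binom{n+q}{n}^{\frac1q}K_q(\tilde{g}_{K})\subseteq \binom{n+p}{n}^{\frac1p}\left(\frac{G_n(K+C_n)}{G_n(K)}\right)^{\frac1p}K_p(\tilde{g}_{K+C_n}).$$
   Context: A convex body is a compact convex set with non-empty interior. $G_n(A)=|A\cap\mathbb{Z}^n|$ for $A\subseteq\mathbb{R}^n$, and $C_n=(-1,1)^n$; $+$ between sets is the Minkowski sum. For a set $L\subseteq\mathbb{R}^n$ (here $L=K$ or $L=K+C_n$) the discrete covariogram is $\tilde{g}_L(x)=G_n(L\cap(x+L))$, $x\in\mathbb{R}^n$. For a measurable $g:\mathbb{R}^n\to[0,\infty)$ with $g(0)>0$ and $p>0$, the $p$-th Ball body of $g$ is $K_p(g)=\{x\in\mathbb{R}^n: p\int_0^\infty r^{p-1}g(rx)\,dr\geq g(0)\}$. For real $p>0$, $\binom{n+p}{n}=\frac{\Gamma(n+p+1)}{\Gamma(n+1)\Gamma(p+1)}$. *)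

(* Defs.v *)
From HB Require Import structures.
From mathcomp Require Import all_boot all_order all_algebra.
From mathcomp Require Import finmap.
From mathcomp Require Import all_classical all_reals all_analysis.

Set Implicit Arguments.
Unset Strict Implicit.
Unset Printing Implicit Defensive.

Import Order.TTheory GRing.Theory Num.Theory.
Import numFieldNormedType.Exports.

Local Open Scope classical_set_scope.
Local Open Scope ring_scope.

(* R^n is 'rV[R]_n with its product topology; n = 0 is allowed (one point). *)

Definition convex_body (R : realType) (n : nat) (K : set 'rV[R]_n) : Prop :=
  [/\ compact K, convex_set K & interior K !=set0].

Definition minkowski_sum (R : realType) (n : nat) (A B : set 'rV[R]_n) :
    set 'rV[R]_n :=
  [set x + y | x in A & y in B].

Definition dilate (R : realType) (n : nat) (c : R) (A : set 'rV[R]_n) :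
    set 'rV[R]_n :=
  [set c *: x | x in A].

Definition translate (R : realType) (n : nat) (x : 'rV[R]_n)
    (A : set 'rV[R]_n) : set 'rV[R]_n :=
  [set x + y | y in A].

Definition open_cube (R : realType) (n : nat) : set 'rV[R]_n :=
  [set x | forall i, -1 < x ord0 i < 1].
Arguments open_cube R n : clear implicits.

Definition integer_lattice (R : realType) (n : nat) : set 'rV[R]_n :=
  range (fun z : 'rV[int]_n => map_mx intr z).
Arguments integer_lattice R n : clear implicits.

(* fset_set is empty on infinite sets, so this is |A `&` Z^n| only when that
   set is finite, in particular for bounded A. *)
Definition lattice_count (R : realType) (n : nat) (A : set 'rV[R]_n) : nat :=
  #|` fset_set (A `&` integer_lattice R n)|.

Definition discrete_covariogram (R : realType) (n : nat) (L : set 'rV[R]_n)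
    (x : 'rV[R]_n) : R :=
  (lattice_count (L `&` translate x L))%:R.

(* The integral is extended-real valued: it is +oo at x = 0 when 0 < g 0.
   The value at r = 0 of the integrand does not matter. *)
Definition ball_body (R : realType) (n : nat) (p : R) (g : 'rV[R]_n -> R) :
    set 'rV[R]_n :=
  [set x | ((g 0)%:E <=
    p%:E * \int[@lebesgue_measure R]_(r in `[0%R, +oo[)
             (r `^ (p - 1) * g (r *: x))%:E)%E].

Definition Gamma (R : realType) (x : R) : R :=
  \int[@lebesgue_measure R]_(t in `[0%R, +oo[) (t `^ (x - 1) * expR (- t)).

(* The binomial coefficient "n + p choose n" for real p > 0. *)
Definition gbinom (R : realType) (n : nat) (p : R) : R :=
  Gamma (n%:R + p + 1) / (Gamma (n%:R + 1) * Gamma (p + 1)).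

(* Main.v *)
Require Import Defs.
From HB Require Import structures.
From mathcomp Require Import all_boot all_order all_algebra.
From mathcomp Require Import finmap.
From mathcomp Require Import all_classical all_reals all_analysis.
From mathcomp Require Import measurable_realfun.
From mathcomp Require Import ring lra zify.

Import Order.TTheory GRing.Theory Num.Theory.
Import numFieldNormedType.Exports.

Set Implicit Arguments.
Unset Strict Implicit.
Unset Printing Implicit Defensive.

Local Open Scope classical_set_scope.
Local Open Scope ring_scope.

(** The inclusion is a one-dimensional statement along the ray through a
point x. Let n > 0; when n = 0 the space is a point. Put f r = g_K (r x),
h r = g_(K + C_n) (r x), f0 = f 0 = G_n K and B_s = binom(n + s, n).
Substituting the dilation factors into the definition of the Ball bodies and
rescaling the integration variable, the ratio G_n (K + C_n) / G_n K cancels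
against h 0, and what remains to be shown is: if
q * int r^(q-1) f r dr >= f0, then
B_p * p * int r^(p-1) h r dr >= f0 * B_q^(p/q) [covariogram_moments].

Two facts give this. The first is a concavity relation between f and h: for
0 <= t <= 1 and f r > 0,
  h (t r)^(1/n) >= (1 - t) f0^(1/n) + t (f r)^(1/n)   [covariogram_concave].
It is the discrete Brunn-Minkowski inequality applied to the lattice points
of K and of K :&: (r x + K), because (1 - t) K + t (K :&: (r x + K)) + C_n
lies in (K + C_n) :&: (t r x + K + C_n).

The discrete inequality [brunn_minkowski_lattice] comes from the continuous
one. Let A and B be the two sets of lattice points, and attach a unit cube to
each of their points. The combination with coefficients 1 - t and t of the two
unions of cubes consists of points y + w with y in (1 - t) A + t B and w in
[0,1)^n; rounding its coordinates down, such a point becomes a lattice point of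
(1 - t) A + t B + C_n. Hence the combination is covered by unit cubes, one for
each of the lattice points to be counted. The continuous inequality is only
about finite unions of boxes, and is obtained by the argument of Hadwiger and
Ohmann [brunn_minkowski_boxes]: cut one of the unions by a coordinate
hyperplane, cut the other in the same ratio, and induct on the number of
boxes. The volume of a sumset is never mentioned: it is replaced by the total
volume of a disjoint family of boxes inside it, and such a family is compared
with a covering by [box_positivity].

The second fact is a form of Berwald's inequality [berwald]. The powers of
tents r |-> max(0, 1 - r/a)^n are the extremal functions: their s-th moments
are a^s / (s B_s) [integral_tent, gbinomE]. If the q-th moment of U = f / f0
exceeds that of a tent L, let T be the last point at which U > 0 is above L.
The concavity relation makes V = h / f0 at least L before T, while U <= L
after T and U <= V everywhere. Multiplying by (r/T)^(q-p), which is at most 1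
before T and at least 1 after T, transports the comparison of U with L for
the exponent q to a comparison of V with L for the exponent p. *)

Lemma nonneg_root (R : realType) (n : nat) (w : R) : (0 < n)%N -> 0 <= w ->
  exists u : R, 0 <= u /\ u ^+ n = w.
Proof.
move=> n0 w0; exists (w `^ n%:R^-1); split; first exact: powR_ge0.
by rewrite -powR_mulrn ?powR_ge0// -powRrM mulVf ?pnatr_eq0 -?lt0n// powRr1.
Qed.

(** * Volumes of boxes and positivity *)

Section boxes.
Variables (R : realType) (n : nat).
Notation vec := 'rV[R]_n.
Notation box := (vec * vec)%type.
Implicit Types (b : box) (x : vec) (i : 'I_n) (s : seq box).

Definition in_box b : pred vec :=
  [pred x : vec | [forall i, b.1 ord0 i <= x ord0 i < b.2 ord0 i]].
Definition side b i : R := b.2 ord0 i - b.1 ord0 i.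
Definition box_vol b : R := \prod_i side b i.
Definition vol s : R := \sum_(b <- s) box_vol b.
Definition proper b : bool := [forall i, b.1 ord0 i < b.2 ord0 i].

(** The one-dimensional case is the positivity of the Lebesgue integral; the
coefficients c may have any sign. *)
Lemma interval_positivity (T : eqType) (s : seq T) (c l h : T -> R) :
  (forall j, j \in s -> l j <= h j) ->
  (forall t : R, 0 <= \sum_(j <- s) c j * (l j <= t < h j)%R%:R) ->
  0 <= \sum_(j <- s) c j * (h j - l j).
Proof.
move=> lh pos; pose mu := @lebesgue_measure R.
rewrite -lee_fin -sumEFin big_seq_cond.
have iI j : mu.-integrable setT
    (fun t : R => (c j * \1_(`[l j, h j[%classic : set R) t)%:E).
  have := integrable_indic_itv (l j) (h j) true true.
  move=> /(@integrableZl _ _ _ mu setT measurableT (c j)).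
  by apply: eq_integrable => // t _; rewrite /= EFinM.
rewrite (eq_bigr (fun j =>
  (\int[mu]_t (c j * \1_(`[l j, h j[%classic : set R) t)%:E)%E)); last first.
  move=> j /andP[js _]; have lhj := lh _ js.
  under eq_integral do rewrite EFinM.
  rewrite integralZl//=; last exact: integrable_indic_itv.
  rewrite integral_indic//= setIT lebesgue_measure_itv/=.
  case: ifP; rewrite lte_fin.
    by rewrite -EFinB -EFinM.
  move/negbT; rewrite -leNgt => hl.
  have -> : h j = l j by apply/eqP; rewrite eq_le hl lhj.
  by rewrite subrr mulr0 mule0.
rewrite -integral_sum//=.
apply: integral_ge0 => t _; rewrite sumEFin lee_fin.
rewrite -big_seq_cond; apply: le_trans (pos t) _; rewrite le_eqVlt; apply/orP; left.
by apply/eqP; apply: eq_bigr => j _; rewrite indicE mem_setE in_itv.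
Qed.

Lemma in_boxE b x :
  (in_box b x)%:R = \prod_i ((b.1 ord0 i <= x ord0 i < b.2 ord0 i)%R%:R : R).
Proof.
rewrite /in_box /=; case: forallP => [H|/forallP].
  by rewrite big1// => i _; rewrite H.
rewrite negb_forall => /existsP[i /negbTE H].
by rewrite (bigD1 i)//= H mul0r.
Qed.

(** A linear inequality between indicator functions of boxes may be integrated.
The coordinates are integrated out one at a time, which needs only the
Lebesgue measure of the line: after the coordinates in the list D have been
treated, the factors with index in D are side lengths and the other ones are
still indicators. *)
Lemma box_positivity (T : eqType) (s : seq T) (c : T -> R) (B : T -> box) :
  (forall j, j \in s -> proper (B j)) ->
  (forall x, 0 <= \sum_(j <- s) c j * (in_box (B j) x)%:R) ->
  0 <= \sum_(j <- s) c j * box_vol (B j).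
Proof.
move=> pB pos.
pose w (D : seq 'I_n) x j i : R := if i \in D then side (B j) i else
   ((B j).1 ord0 i <= x ord0 i < (B j).2 ord0 i)%R%:R.
suff H (D : seq 'I_n) x : 0 <= \sum_(j <- s) c j * \prod_i w D x j i.
  apply: (le_trans (H (enum 'I_n) 0)); rewrite le_eqVlt; apply/orP; left.
  apply/eqP/eq_bigr => j _; congr (_ * _); apply: eq_bigr => i _.
  by rewrite /w mem_enum.
elim: D x => [|k D IH] x.
  apply: le_trans (pos x) _; rewrite le_eqVlt; apply/orP; left; apply/eqP.
  by apply: eq_bigr => j _; rewrite in_boxE.
have [kD|kD] := boolP (k \in D).
  apply: le_trans (IH x) _; rewrite le_eqVlt; apply/orP; left; apply/eqP.
  apply: eq_bigr => j _; congr (_ * _); apply: eq_bigr => i _.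
  by rewrite /w in_cons; case: eqP => [->|]//=; rewrite kD.
pose c' j := c j * \prod_(i < n | i != k) w D x j i.
have := @interval_positivity T s c' (fun j => (B j).1 ord0 k) (fun j => (B j).2 ord0 k).
have -> : \sum_(j <- s) c j * \prod_i w (k :: D) x j i =
   \sum_(j <- s) c' j * ((B j).2 ord0 k - (B j).1 ord0 k).
  apply: eq_bigr => j _; rewrite (bigD1 k)//= {1}/w mem_head /c' mulrA mulrAC.
  congr (_ * _ * _); apply: eq_bigr => i /negbTE ik.
  by rewrite /w in_cons ik.
apply=> [j js|t].
  by have /forallP/(_ k)/ltW := pB _ js.
pose x' : vec := \row_i (if i == k then t else x ord0 i).
apply: le_trans (IH x') _; rewrite le_eqVlt; apply/orP; left; apply/eqP.
apply: eq_bigr => j _; rewrite (bigD1 k)//= {1}/w (negbTE kD) mxE eqxx mulrCA mulrC.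
congr (_ * _ * _); apply: eq_bigr => i /negbTE ik.
by rewrite /w mxE ik.
Qed.
End boxes.

(** Brunn-Minkowski for two boxes: apply the arithmetic-geometric mean
inequality to the ratios u i / (u i + v i) and to v i / (u i + v i), whose
means add up to 1. *)
Lemma prod_add_root_le (R : realType) (I : finType) (k := #|I|)
    (u v : I -> R) (a b : R) : (0 < k)%N ->
  (forall i, 0 < u i) -> (forall i, 0 < v i) -> 0 <= a -> 0 <= b ->
  a ^+ k = \prod_i u i -> b ^+ k = \prod_i v i ->
  (a + b) ^+ k <= \prod_i (u i + v i).
Proof.
move=> k0 u0 v0 a0 b0 ha hb.
have uv0 i : 0 < u i + v i by rewrite addr_gt0.
have k0R : k%:R != 0 :> R by rewrite pnatr_eq0 -lt0n.
have P0 : 0 < \prod_i (u i + v i) by apply: prodr_gt0.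
pose g := (\prod_i (u i + v i)) `^ k%:R^-1.
have g0 : 0 < g by rewrite powR_gt0.
have gk : g ^+ k = \prod_i (u i + v i).
  by rewrite -powR_mulrn ?ltW// -powRrM mulVf// powRr1// ltW.
rewrite -gk; rewrite ler_pXn2r// ?nnegrE ?addr_ge0 ?(ltW g0)//.
have key (w : I -> R) (r : R) : (forall i, 0 < w i) -> 0 <= r ->
    r ^+ k = \prod_i w i -> r / g <= (\sum_i w i / (u i + v i)) / k%:R.
  move=> w0 r0 hr.
  have W i : 0 <= w i / (u i + v i) by rewrite divr_ge0// ltW.
  rewrite -(@ler_pXn2r _ k)// ?nnegrE ?divr_ge0 ?sumr_ge0 ?(ltW g0)//.
  rewrite expr_div_n hr gk -prodf_div.
  have [H _] := @leif_AGM R I predT (fun i => w i / (u i + v i)) (fun i _ => W i).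
  exact: H.
have := lerD (key _ _ u0 a0 ha) (key _ _ v0 b0 hb).
rewrite -!mulrDl -big_split/= (eq_bigr (fun=> 1)); last first.
  by move=> i _; rewrite -mulrDl divff// gt_eqF.
by rewrite sumr_const -[#|_|]/k divff// ler_pdivrMr// mul1r.
Qed.

(** * Cutting families of boxes by hyperplanes *)

Section brunn_minkowski.
Variables (R : realType) (n : nat).
Notation vec := 'rV[R]_n.
Notation box := (vec * vec)%type.
Implicit Types (b : box) (x : vec) (i : 'I_n) (s A B P : seq box) (c : R).

(** Boxes are half-open, so a common bounding hyperplane separates them; this is
the form of disjointness that survives cutting and provides hyperplanes to cut
along. *)
Definition separated b b' : bool :=
  [exists i, (b.2 ord0 i <= b'.1 ord0 i) || (b'.2 ord0 i <= b.1 ord0 i)].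

Definition covers s x : bool := has (fun b => in_box b x) s.

Definition box_lt i c b : box :=
  (b.1, \row_j (if j == i then Num.min (b.2 ord0 i) c else b.2 ord0 j)).
Definition box_ge i c b : box :=
  (\row_j (if j == i then Num.max (b.1 ord0 i) c else b.1 ord0 j), b.2).
(** Empty pieces are dropped, so that a cut can make a family strictly
shorter. *)
Definition cut_lt i c s := [seq box_lt i c b | b <- s & b.1 ord0 i < c].
Definition cut_ge i c s := [seq box_ge i c b | b <- s & c < b.2 ord0 i].

Lemma in_boxP b x :
  reflect (forall i, b.1 ord0 i <= x ord0 i < b.2 ord0 i) (in_box b x).
Proof. exact: forallP. Qed.

Lemma properP b : reflect (forall i, b.1 ord0 i < b.2 ord0 i) (proper b).
Proof. exact: forallP. Qed.

Lemma box_vol_gt0 b : proper b -> 0 < box_vol b.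
Proof. by move=> /properP pb; apply: prodr_gt0 => i _; rewrite subr_gt0. Qed.

Lemma vol_gt0 s : all (@proper R n) s -> s != [::] -> 0 < vol s.
Proof.
case: s => // b s /= /andP[pb ps] _; rewrite /vol big_cons.
rewrite ltr_pwDl ?box_vol_gt0//.
by rewrite big_seq; apply: sumr_ge0 => b' /(allP ps)/box_vol_gt0/ltW.
Qed.

Lemma proper_cut_lt i c s : all (@proper R n) s -> all (@proper R n) (cut_lt i c s).
Proof.
move=> /allP ps; apply/allP => _ /mapP[b + ->].
rewrite mem_filter => /andP[bc /ps/properP pb]; apply/properP => j /=.
by rewrite mxE; case: eqP => [->|_]//; rewrite lt_min pb bc.
Qed.

Lemma proper_cut_ge i c s : all (@proper R n) s -> all (@proper R n) (cut_ge i c s).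
Proof.
move=> /allP ps; apply/allP => _ /mapP[b + ->].
rewrite mem_filter => /andP[bc /ps/properP pb]; apply/properP => j /=.
by rewrite mxE; case: eqP => [->|_]//; rewrite gt_max pb bc.
Qed.

Lemma covers_cut_lt i c s x : covers (cut_lt i c s) x -> covers s x /\ x ord0 i < c.
Proof.
move=> /hasP[_ /mapP[b + ->]]; rewrite mem_filter => /andP[bc bs] /in_boxP xb.
have := xb i; rewrite /= mxE eqxx lt_min => /and3P[_ _ ->]; split=> //.
apply/hasP; exists b => //; apply/in_boxP => j; have := xb j; rewrite /= mxE.
by case: eqP => [->|//]; rewrite lt_min => /and3P[-> ->].
Qed.

Lemma covers_cut_ge i c s x : covers (cut_ge i c s) x -> covers s x /\ c <= x ord0 i.
Proof.
move=> /hasP[_ /mapP[b + ->]]; rewrite mem_filter => /andP[bc bs] /in_boxP xb.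
have := xb i; rewrite /= mxE eqxx ge_max => /andP[/andP[_ ->] _]; split=> //.
apply/hasP; exists b => //; apply/in_boxP => j; have := xb j; rewrite /= mxE.
by case: eqP => [->|//]; rewrite ge_max => /andP[/andP[-> _] ->].
Qed.

Lemma separated_cut_lt i c s :
  pairwise separated s -> pairwise separated (cut_lt i c s).
Proof.
move=> ps; rewrite pairwise_map; apply: sub_pairwise (pairwise_filter _ ps).
move=> b b' /existsP[j bb]; apply/existsP; exists j.
rewrite /= !mxE; case: eqP => // ji; move: bb; rewrite ji !ge_min.
by case/orP=> ->; rewrite ?orbT.
Qed.

Lemma separated_cut_ge i c s :
  pairwise separated s -> pairwise separated (cut_ge i c s).
Proof.
move=> ps; rewrite pairwise_map; apply: sub_pairwise (pairwise_filter _ ps).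
move=> b b' /existsP[j bb]; apply/existsP; exists j.
rewrite /= !mxE; case: eqP => // ji; move: bb; rewrite ji !le_max.
by case/orP=> ->; rewrite ?orbT.
Qed.

Definition face_vol i b : R := \prod_(j < n | j != i) side b j.
(** The abscissa along axis i at which the hyperplane x_i = c cuts b, with c moved
into the box when it misses it. *)
Definition clamp i c b : R := Num.max (b.1 ord0 i) (Num.min (b.2 ord0 i) c).

(** The sum is over all of s: a dropped box has clamped cut at its lower face. In
this form the volume is visibly continuous in c. *)
Lemma vol_cut_lt i c s : all (@proper R n) s ->
  vol (cut_lt i c s) = \sum_(b <- s) face_vol i b * (clamp i c b - b.1 ord0 i).
Proof.
move=> /allP ps; rewrite /vol big_map big_filter big_mkcond/=.
rewrite big_seq [RHS]big_seq; apply: eq_bigr => b /ps /properP/(_ i) pb.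
rewrite /clamp; case: ltP => bc.
  rewrite /box_vol (bigD1 i)//= mulrC; congr (_ * _).
    by apply: eq_bigr => j /negbTE ji; rewrite /side mxE ji.
  by rewrite /side mxE eqxx (max_idPr _)// le_min (ltW pb) ltW.
by rewrite (max_idPl _) ?subrr ?mulr0// ge_min bc orbT.
Qed.

Lemma vol_cut_ge i c s : all (@proper R n) s ->
  vol (cut_ge i c s) = \sum_(b <- s) face_vol i b * (b.2 ord0 i - clamp i c b).
Proof.
move=> /allP ps; rewrite /vol big_map big_filter big_mkcond/=.
rewrite big_seq [RHS]big_seq; apply: eq_bigr => b /ps /properP/(_ i) pb.
rewrite /clamp; case: ltP => bc.
  rewrite /box_vol (bigD1 i)//= mulrC; congr (_ * _).
    by apply: eq_bigr => j /negbTE ji; rewrite /side mxE ji.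
  by rewrite /side mxE eqxx.
by rewrite (max_idPr (ltW pb)) subrr mulr0.
Qed.

Lemma box_volE i b : box_vol b = face_vol i b * side b i.
Proof. by rewrite /box_vol (bigD1 i)//= mulrC. Qed.

Lemma vol_cut i c s : all (@proper R n) s ->
  vol s = vol (cut_lt i c s) + vol (cut_ge i c s).
Proof.
move=> ps; rewrite vol_cut_lt// vol_cut_ge// -big_split/=.
by apply: eq_bigr => b _; rewrite -mulrDr addrC subrKA (box_volE i).
Qed.

(** Intermediate value theorem for the volume below the hyperplane, which grows
from 0 to vol s. *)
Lemma cut_fraction i s (t : R) : all (@proper R n) s -> 0 <= t <= 1 ->
  exists c, vol (cut_lt i c s) = t * vol s.
Proof.
move=> ps t01; pose f c := \sum_(b <- s) face_vol i b * (clamp i c b - b.1 ord0 i).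
pose M := \sum_(b <- s) (`|b.1 ord0 i| + `|b.2 ord0 i|).
have M0 : 0 <= M by apply: sumr_ge0 => b _; rewrite addr_ge0.
have bM b : b \in s -> `|b.1 ord0 i| <= M /\ `|b.2 ord0 i| <= M.
  move=> bs; have : `|b.1 ord0 i| + `|b.2 ord0 i| <= M.
    rewrite /M (big_rem b)//= lerDl; apply: sumr_ge0 => b' _; exact: addr_ge0.
  move=> h; split; apply: le_trans h; first by rewrite lerDl.
  by rewrite lerDr.
have v0 : 0 <= vol s.
  by rewrite /vol big_seq; apply: sumr_ge0 => b' /(allP ps)/box_vol_gt0/ltW.
have fm : f (- M) = 0.
  rewrite /f big_seq big1// => b /bM[l _]; rewrite /clamp (max_idPl _) ?subrr ?mulr0//.
  by rewrite ge_min lerNl (le_trans _ l) ?orbT// -normrN ler_norm.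
have fM : f M = vol s.
  rewrite /f /vol big_seq [RHS]big_seq; apply: eq_bigr => b bs.
  have [_ h] := bM _ bs.
  rewrite /clamp (min_idPl _) ?(max_idPr _) -?box_volE//.
    by have /properP/(_ i)/ltW := allP ps _ bs.
  by rewrite (le_trans _ h)// ler_norm.
have cf : continuous f.
  move=> x; rewrite /f; elim: (s) => [|b s' IH].
    rewrite (_ : (fun c => _) = cst 0); first exact: cvg_cst.
    by apply/funext => c; rewrite big_nil.
  rewrite (_ : (fun c => _) = (fun c => face_vol i b * (clamp i c b - b.1 ord0 i)) \+
     (fun c => \sum_(b <- s') face_vol i b * (clamp i c b - b.1 ord0 i))); last first.
    by apply/funext => c /=; rewrite big_cons.
  apply: cvgD; last exact: IH.
  apply: cvgM; first exact: cvg_cst.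
  apply: cvgB; last exact: cvg_cst.
  apply: continuous_max; first exact: cvg_cst.
  by apply: continuous_min; [exact: cvg_cst|exact: cvg_id].
have [| | |c _ fc] := @IVT R f (- M) M (t * vol s).
- by rewrite ge0_cp.
- by apply: continuous_subspaceT.
- rewrite fm fM ge_min le_max; case/andP: t01 => t0 t1.
  by rewrite mulr_ge0//= ler_piMl// orbT.
by exists c; rewrite vol_cut_lt.
Qed.

Definition in_sumset A B z : Prop :=
  exists x y, [/\ covers A x, covers B y & z = x + y].

Lemma in_sumsetC A B z : in_sumset A B z -> in_sumset B A z.
Proof. by move=> [x [y [? ? ->]]]; exists y, x; rewrite addrC. Qed.

End brunn_minkowski.

(** * The Brunn-Minkowski inequality for unions of boxes *)

Section hadwiger_ohmann.
Variables (R : realType) (n : nat).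
Hypothesis n0 : (0 < n)%N.
Notation vec := 'rV[R]_n.
Notation box := (vec * vec)%type.
Implicit Types (x z : vec) (i : 'I_n) (A B P : seq box) (c : R).

Definition box_family A := all (@proper R n) A && pairwise (@separated R n) A.

(** The sumset contains a disjoint family of boxes of total volume at least
(a + b)^n. Disjointness and inclusion are expressed together by a pointwise
inequality between indicators, the form consumed by box_positivity. *)
Definition sumset_packed A B (a b : R) : Prop := exists P,
  [/\ all (@proper R n) P,
      forall z, \sum_(q <- P) (in_box q z)%:R <= `[< in_sumset A B z >]%:R :> R &
      (a + b) ^+ n <= vol P].

Lemma sumset_packedC A B a b : sumset_packed A B a b -> sumset_packed B A b a.
Proof.
move=> [P [pP hP vP]]; exists P; split=> // [z|]; last by rewrite addrC.
rewrite (_ : `[< in_sumset B A z >] = `[< in_sumset A B z >])//.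
by apply/asbool_equiv_eq; split=> /in_sumsetC.
Qed.

Lemma packed_boxes (u v : box) (a b : R) : proper u -> proper v ->
  0 <= a -> 0 <= b -> a ^+ n = box_vol u -> b ^+ n = box_vol v ->
  sumset_packed [:: u] [:: v] a b.
Proof.
move=> /properP pu /properP pv a0 b0 ha hb; exists [:: (u.1 + v.1, u.2 + v.2)]; split.
- rewrite /= andbT; apply/properP => i; rewrite /= !mxE.
  by apply: ltrD; [exact: pu|exact: pv].
- move=> z; rewrite big_seq1; case: (in_boxP (_, _) z) => // zb.
  rewrite asboolT//.
  (* z is the sum of the points at the same relative position th in u and in v. *)
  pose th i := (z ord0 i - (u.1 ord0 i + v.1 ord0 i)) / (side u i + side v i).
  have d0 i : 0 < side u i + side v i by rewrite addr_gt0// subr_gt0.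
  have thP i : 0 <= th i < 1.
    have := zb i; rewrite /= !mxE => /andP[h1 h2].
    rewrite /th divr_ge0 ?subr_ge0 ?(ltW (d0 i))//= ltr_pdivrMr// mul1r.
    by rewrite /side; lra.
  pose pt (w : box) : vec := \row_i (w.1 ord0 i + th i * side w i).
  have ptP (w : box) : (forall i, w.1 ord0 i < w.2 ord0 i) -> covers [:: w] (pt w).
    move=> pw; rewrite /covers /= orbF; apply/in_boxP => i; rewrite mxE.
    have /andP[t0 t1] := thP i.
    have s0 : 0 < side w i by rewrite subr_gt0.
    rewrite lerDl mulr_ge0 ?(ltW s0)//=.
    have -> : w.2 ord0 i = w.1 ord0 i + side w i by rewrite /side addrC subrK.
    by rewrite ltrD2l gtr_pMl.
  exists (pt u), (pt v); split; [exact: ptP|exact: ptP|].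
  apply/rowP => i; rewrite !mxE addrACA -mulrDr /th divfK ?gt_eqF//.
  by rewrite [RHS]addrC subrK.
- rewrite /vol big_seq1 /box_vol.
  rewrite (eq_bigr (fun i => side u i + side v i)); last first.
    by move=> i _; rewrite /side /= !mxE; ring.
  have := @prod_add_root_le R 'I_n (side u) (side v) a b; rewrite card_ord; apply=> //.
  + by move=> i; rewrite subr_gt0.
  + by move=> i; rewrite subr_gt0.
Qed.

Lemma vol_neq0 A : vol A != 0 -> A != [::].
Proof. by apply: contra_neq => ->; rewrite /vol big_nil. Qed.

(** Cut between two separated boxes: each side loses one of them. *)
Lemma has_cut A : box_family A -> (1 < size A)%N -> exists i c,
  [/\ (size (cut_lt i c A) < size A)%N, (size (cut_ge i c A) < size A)%N,
   cut_lt i c A != [::] & cut_ge i c A != [::]].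
Proof.
move=> /andP[pA sA] A2.
suff [i [c [u [v [[uA vA] [u1 u2] [v1 v2]]]]]] : exists i c u v,
   [/\ u \in A /\ v \in A, u.1 ord0 i < c /\ ~~ (c < u.2 ord0 i) &
    ~~ (v.1 ord0 i < c) /\ c < v.2 ord0 i].
  exists i, c; rewrite !size_map !size_filter.
  have hs (T : eqType) (q : pred T) (w : T) (s : seq T) :
      w \in s -> ~~ q w -> (count q s < size s)%N.
    move=> ws qw; rewrite -(count_predC q s) -[ltnLHS]addn0 ltn_add2l -has_count.
    by apply/hasP; exists w.
  split.
  - exact: hs vA _.
  - exact: hs uA _.
  - rewrite -size_eq0 size_map size_filter -lt0n -has_count; apply/hasP; by exists u.
  - rewrite -size_eq0 size_map size_filter -lt0n -has_count; apply/hasP; by exists v.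
case: A A2 pA sA => [|b1 [|b2 A]]// _ /= /and3P[/properP p1 /properP p2 _].
move=> /andP[/andP[/existsP[i /orP[h|h]] _] _].
- exists i, (b1.2 ord0 i), b1, b2; rewrite !inE !eqxx orbT -!leNgt p1 h; split=> //.
  by split=> //; apply: le_lt_trans h _; exact: p2.
- exists i, (b2.2 ord0 i), b2, b1; rewrite !inE !eqxx orbT -!leNgt p2 h; split=> //.
  by split=> //; apply: le_lt_trans h _; exact: p1.
Qed.

(** The inductive step. If B is cut in the same volume ratio t : 1 - t as A, the
lower parts and the upper parts contribute t (a + b)^n and (1 - t) (a + b)^n,
and their sumsets are separated by the hyperplane x_i = c + d. *)
Lemma packed_cut A B (a b : R) :
  (forall A' B' a' b', (size A' < size A)%N -> (size B' <= size B)%N ->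
    box_family A' -> box_family B' -> A' != [::] -> B' != [::] ->
    0 <= a' -> 0 <= b' -> a' ^+ n = vol A' -> b' ^+ n = vol B' ->
    sumset_packed A' B' a' b') ->
  (1 < size A)%N -> box_family A -> box_family B -> B != [::] ->
  0 <= a -> 0 <= b -> a ^+ n = vol A -> b ^+ n = vol B -> sumset_packed A B a b.
Proof.
move=> IH A2 fA fB B0 a0 b0 ha hb.
have [i [c [s1 s2 n1 n2]]] := has_cut fA A2.
case/andP: (fA) => pA sA; case/andP: (fB) => pB sB.
have vA0 : 0 < vol A by apply: vol_gt0 => //; rewrite -size_eq0 -lt0n ltnW.
have vB0 : 0 < vol B by exact: vol_gt0.
have v1 : 0 < vol (cut_lt i c A) by apply: vol_gt0 => //; exact: proper_cut_lt.
have v2 : 0 < vol (cut_ge i c A) by apply: vol_gt0 => //; exact: proper_cut_ge.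
have vcA := vol_cut i c pA.
pose t := vol (cut_lt i c A) / vol A.
have t0 : 0 < t by rewrite divr_gt0.
have t1 : t < 1 by rewrite ltr_pdivrMr// mul1r vcA ltrDl.
have tA : vol (cut_lt i c A) = t * vol A by rewrite divfK// gt_eqF.
have tA' : vol (cut_ge i c A) = (1 - t) * vol A.
  by rewrite mulrBl mul1r -tA {1}vcA addrAC subrr add0r.
have [d tB] : exists d, vol (cut_lt i d B) = t * vol B.
  by apply: cut_fraction => //; rewrite !ltW.
have tB' : vol (cut_ge i d B) = (1 - t) * vol B.
  by rewrite mulrBl mul1r -tB {1}(vol_cut i d pB) addrAC subrr add0r.
have [r [r0 rt]] := nonneg_root n0 (ltW t0).
have [r' [r'0 rt']] : exists u : R, 0 <= u /\ u ^+ n = 1 - t.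
  by apply: nonneg_root; rewrite // subr_ge0 ltW.
have [P1 [pP1 cP1 vP1]] : sumset_packed (cut_lt i c A) (cut_lt i d B) (r * a) (r * b).
  apply: IH => //.
  - by rewrite size_map size_filter count_size.
  - by rewrite /box_family proper_cut_lt ?separated_cut_lt.
  - by rewrite /box_family proper_cut_lt ?separated_cut_lt.
  - by apply: vol_neq0; rewrite tB mulf_neq0 ?gt_eqF.
  - exact: mulr_ge0.
  - exact: mulr_ge0.
  - by rewrite exprMn rt ha tA.
  - by rewrite exprMn rt hb tB.
have [P2 [pP2 cP2 vP2]] : sumset_packed (cut_ge i c A) (cut_ge i d B) (r' * a) (r' * b).
  apply: IH => //.
  - by rewrite size_map size_filter count_size.
  - by rewrite /box_family proper_cut_ge ?separated_cut_ge.
  - by rewrite /box_family proper_cut_ge ?separated_cut_ge.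
  - by apply: vol_neq0; rewrite tB' mulf_neq0 ?gt_eqF ?subr_gt0.
  - exact: mulr_ge0.
  - exact: mulr_ge0.
  - by rewrite exprMn rt' ha tA'.
  - by rewrite exprMn rt' hb tB'.
exists (P1 ++ P2); split.
- by rewrite all_cat pP1.
- move=> z; rewrite big_cat/=; apply: le_trans (lerD (cP1 z) (cP2 z)) _.
  case: asboolP => [[x [y [/covers_cut_lt[Ax xc] /covers_cut_lt[By yd] zE]]]|_].
    rewrite asboolF ?addr0; last first.
      move=> [x' [y' [/covers_cut_ge[_ xc'] /covers_cut_ge[_ yd'] zE']]].
      move: zE'; rewrite zE => /rowP/(_ i); rewrite !mxE => e.
      by have := ltrD xc yd; rewrite e ltNge lerD.
    by rewrite asboolT//; exists x, y.
  rewrite add0r.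
  case: asboolP => // -[x [y [/covers_cut_ge[Ax _] /covers_cut_ge[By _] zE]]].
  by rewrite asboolT//; exists x, y.
- rewrite /vol big_cat/=; apply: le_trans (lerD vP1 vP2).
  by rewrite -!mulrDr !exprMn -mulrDl rt rt' (addrC t) subrK mul1r.
Qed.

Theorem brunn_minkowski_boxes A B (a b : R) :
  box_family A -> box_family B -> A != [::] -> B != [::] ->
  0 <= a -> 0 <= b -> a ^+ n = vol A -> b ^+ n = vol B -> sumset_packed A B a b.
Proof.
move: {2}(size A + size B)%N (leqnn (size A + size B)) => N.
elim: N A B a b => [|N IH] A B a b.
  by rewrite leqn0 addn_eq0 size_eq0 => /andP[/eqP->].
move=> sN fA fB A0 B0 a0 b0 ha hb.
have [A2|A1] := ltnP 1 (size A).
  apply: packed_cut => // A' B' a' b' sA sB; apply: IH.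
  by rewrite -ltnS (leq_trans _ sN)// -addSn leq_add.
have [B2|B1] := ltnP 1 (size B).
  apply: sumset_packedC; apply: packed_cut => // A' B' a' b' sA sB; apply: IH.
  by rewrite -ltnS (leq_trans _ sN)// -addSn addnC leq_add.
case: A A0 A1 fA ha {sN} => [|u [|]]//= _ _ /andP[/= /andP[pu _] _] ha.
case: B B0 B1 fB hb => [|v [|]]//= _ _ /andP[/= /andP[pv _] _] hb.
apply: packed_boxes => //.
- by rewrite ha /vol big_seq1.
- by rewrite hb /vol big_seq1.
Qed.
End hadwiger_ohmann.

(** * The discrete Brunn-Minkowski inequality *)

Section discrete.
Variables (R : realType) (n : nat).
Hypothesis n0 : (0 < n)%N.
Notation vec := 'rV[R]_n.
Notation box := (vec * vec)%type.
Implicit Types (x y z : vec) (A B T : seq vec) (c : R).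

Definition cube c x : box := (c *: x, \row_i (c * (x ord0 i + 1))).

Lemma cube_proper c x : 0 < c -> proper (cube c x).
Proof. by move=> c0; apply/properP => i; rewrite /= !mxE ltr_pM2l// ltrDl. Qed.

Lemma cube_vol c x : box_vol (cube c x) = c ^+ n.
Proof.
rewrite /box_vol (eq_bigr (fun=> c)) ?prodr_const ?card_ord// => i _.
by rewrite /side /= !mxE -mulrBr addrAC subrr add0r mulr1.
Qed.

Lemma vol_cubes c A : vol [seq cube c x | x <- A] = c ^+ n * (size A)%:R.
Proof.
rewrite /vol big_map (eq_bigr (fun=> c ^+ n)) => [|x _]; last exact: cube_vol.
by rewrite big_const_seq count_predT iter_addr_0 mulr_natr.
Qed.

Lemma cube_family c A : 0 < c -> uniq A -> {in A, forall x, integer_lattice R n x} ->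
  box_family [seq cube c x | x <- A].
Proof.
move=> c0 uA lA; apply/andP; split.
  by apply/allP => _ /mapP[x _ ->]; exact: cube_proper.
rewrite pairwise_map.
have : pairwise (fun x y => x != y) A by rewrite -uniq_pairwise.
apply: (@sub_in_pairwise _ (mem A) _ _ _ A (allss A)) => x y xA yA /= xy.
have [u _ ux] := lA _ xA; have [v _ vy] := lA _ yA.
have /existsP[i xyi] : [exists i, x ord0 i != y ord0 i].
  rewrite -negb_forall; apply: contra xy => /forallP h; apply/eqP/rowP => i.
  exact/eqP/h.
apply/existsP; exists i; rewrite !mxE !ler_pM2l//.
move: xyi; rewrite -ux -vy !mxE eqr_int neq_lt => /orP[] h; apply/orP.
  by left; rewrite -[1]/(1%:~R) -intrD ler_int lezD1.
by right; rewrite -[1]/(1%:~R) -intrD ler_int lezD1.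
Qed.

(** The sum of the two scaled unions of unit cubes is covered by the unit cubes
at the points of T, through rounding down. *)
Lemma brunn_minkowski_lattice_seq A B T (t a b : R) : 0 < t < 1 ->
  uniq A -> uniq B -> A != [::] -> B != [::] ->
  {in A, forall x, integer_lattice R n x} ->
  {in B, forall x, integer_lattice R n x} ->
  (forall x y e, x \in A -> y \in B -> open_cube R n e ->
     integer_lattice R n ((1 - t) *: x + t *: y + e) ->
     (1 - t) *: x + t *: y + e \in T) ->
  0 <= a -> 0 <= b -> a ^+ n = (size A)%:R -> b ^+ n = (size B)%:R ->
  ((1 - t) * a + t * b) ^+ n <= (size T)%:R.
Proof.
move=> /andP[t0 t1] uA uB A0 B0 lA lB hT a0 b0 ha hb.
have t1' : 0 < 1 - t by rewrite subr_gt0.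
have [||||||P [pP cP vP]] := @brunn_minkowski_boxes R n n0
    [seq cube (1 - t) x | x <- A] [seq cube t x | x <- B] ((1 - t) * a) (t * b)
    (cube_family t1' uA lA) (cube_family t0 uB lB).
- by case: (A) A0.
- by case: (B) B0.
- by rewrite mulr_ge0// ltW.
- by rewrite mulr_ge0// ltW.
- by rewrite vol_cubes exprMn ha.
- by rewrite vol_cubes exprMn hb.
apply: le_trans vP _.
(* Packing boxes carry weight -1, covering cubes weight 1. *)
pose s : seq (R * box) := [seq (-1, q) | q <- P] ++ [seq (1, cube 1 z) | z <- T].
have := @box_positivity R n _ s fst snd; rewrite {}/s.
rewrite !big_cat !big_map /= -big_distrr/= mulN1r.
rewrite (eq_bigr (fun=> 1) (r := T)); last by move=> z _; rewrite cube_vol expr1n mulr1.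
rewrite big_const_seq count_predT iter_addr_0 addrC subr_ge0; apply.
- move=> j; rewrite mem_cat => /orP[/mapP[q qP ->]|/mapP[z _ ->]] /=.
    by exact: (allP pP).
  exact: cube_proper.
- move=> z; rewrite big_cat !big_map/= -big_distrr/= mulN1r addrC subr_ge0.
  apply: le_trans (cP z) _.
  case: asboolP => [[x [y [/hasP[/= _ /mapP[u uA' ->] hx]
      /hasP[/= _ /mapP[v vB ->] hy] zxy]]]|_];
    last by apply: sumr_ge0 => w _; rewrite mul1r.
  pose w : vec := map_mx intr (\row_i Num.floor (z ord0 i)).
  have lw : integer_lattice R n w by exists (\row_i Num.floor (z ord0 i)).
  have zw i : w ord0 i <= z ord0 i < w ord0 i + 1.
    by rewrite !mxE floor_le -[1]/(1%:~R) -intrD floorD1_gt.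
  (* Two numbers in [0,1) differ by less than 1, so w is the combination of the
     lattice points u and v up to a vector of the open cube. *)
  have wT : w \in T.
    pose e : vec := w - ((1 - t) *: u + t *: v).
    have -> : w = (1 - t) *: u + t *: v + e by rewrite /e addrC subrK.
    apply: hT => //; last by rewrite /e addrC subrK.
    move=> i; have /andP[w1 w2] := zw i.
    move: w1 w2; rewrite /e !mxE -[Num.floor _]/(Num.floor (z ord0 i)).
    have := in_boxP _ _ hx i; have := in_boxP _ _ hy i; rewrite /= !mxE zxy mxE.
    move=> /andP[h1 h2] /andP[h3 h4] h5 h6.
    by apply/andP; split; lra.
  have zc : in_box (cube 1 w) z.
    by apply/in_boxP => i; have := zw i; rewrite /= !mxE !mul1r.
  rewrite (big_rem w)//= mul1r zc lerDl.
  by apply: sumr_ge0 => q _; rewrite mul1r.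
Qed.

Lemma brunn_minkowski_lattice (SA SB ST : set vec) (t a b : R) : 0 < t < 1 ->
  finite_set (SA `&` integer_lattice R n) ->
  finite_set (SB `&` integer_lattice R n) ->
  finite_set (ST `&` integer_lattice R n) ->
  (0 < lattice_count SA)%N -> (0 < lattice_count SB)%N ->
  (forall x y e, SA x -> SB y -> open_cube R n e -> ST ((1 - t) *: x + t *: y + e)) ->
  0 <= a -> 0 <= b ->
  a ^+ n = (lattice_count SA)%:R -> b ^+ n = (lattice_count SB)%:R ->
  ((1 - t) * a + t * b) ^+ n <= (lattice_count ST)%:R.
Proof.
move=> t01 fA fB fT cA cB hT a0 b0 ha hb.
have mem (S : set vec) x : finite_set (S `&` integer_lattice R n) ->
    (x \in enum_fset (fset_set (S `&` integer_lattice R n))) =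
    (x \in S `&` integer_lattice R n).
  by move=> fS; rewrite -in_fset_set.
have ne (S : set vec) : (0 < lattice_count S)%N ->
    enum_fset (fset_set (S `&` integer_lattice R n)) != [::].
  by move=> cS; rewrite -size_eq0 -lt0n.
apply: (brunn_minkowski_lattice_seq t01 _ _ (ne _ cA) (ne _ cB) _ _ _ a0 b0 ha hb) => //.
- exact: fset_uniq.
- exact: fset_uniq.
- by move=> x; rewrite mem// inE => -[].
- by move=> x; rewrite mem// inE => -[].
- move=> x y e; rewrite !mem// !inE => -[xS _] [yS _] hc lxy; split=> //.
  exact: hT.
Qed.
End discrete.

(** * The discrete covariogram *)

Section covariogram.
Variables (R : realType) (n : nat).
Notation vec := 'rV[R]_n.
Implicit Types (x y z : vec) (K L S : set vec).

Definition coord_bounded S := exists M : R, forall x, S x -> forall i, `|x ord0 i| <= M.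
Definition segment_closed S := forall x y (t : R), 0 <= t <= 1 -> S x -> S y ->
  S ((1 - t) *: x + t *: y).

Lemma compact_coord_bounded K : compact K -> coord_bounded K.
Proof.
move=> /compact_bounded[M [_ hM]]; exists (M + 1) => x Kx i.
have := hM (M + 1) _ x Kx; rewrite ltrDl ltr01 => /(_ isT); apply: le_trans.
rewrite [leRHS]mx_normrE (bigD1 (ord0, i))//= le_max lexx//.
Qed.

Lemma convex_segment_closed K : convex_set K -> segment_closed K.
Proof.
move=> cK x y t t01 Kx Ky.
have t01' : (0 <= t <= 1)%R := t01.
have := cK y x (Itv01 (andP t01').1 (andP t01').2).
by rewrite !inE => /(_ Ky Kx); rewrite /conv /= addrC.
Qed.

Lemma minkowski_coord_bounded K L :
  coord_bounded K -> coord_bounded L -> coord_bounded (minkowski_sum K L).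
Proof.
move=> [M hM] [N hN]; exists (M + N) => _ [x Kx [y Ly <-]] i.
by rewrite mxE (le_trans (ler_normD _ _))// lerD ?hM ?hN.
Qed.

Lemma minkowski_segment_closed K L :
  segment_closed K -> segment_closed L -> segment_closed (minkowski_sum K L).
Proof.
move=> hK hL _ _ t t01 [x Kx [y Ly <-]] [x' Kx' [y' Ly' <-]].
exists ((1 - t) *: x + t *: x'); first exact: hK.
exists ((1 - t) *: y + t *: y'); first exact: hL.
by rewrite !scalerDr addrACA.
Qed.

Lemma open_cube_coord_bounded : coord_bounded (open_cube R n).
Proof. by exists 1 => x hx i; rewrite ler_norml; have /andP[/ltW-> /ltW->] := hx i. Qed.

Lemma open_cube_segment_closed : segment_closed (open_cube R n).
Proof.
move=> x y t /andP[t0 t1] hx hy i; rewrite !mxE.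
have /andP[x1 x2] := hx i; have /andP[y1 y2] := hy i.
have [->|tn0] := eqVneq t 0; first by rewrite subr0 !mul0r mul1r addr0 x1.
have tp : 0 < t by rewrite lt_neqAle eq_sym tn0.
have h1 : 0 <= (1 - t) * (1 - x ord0 i) by rewrite mulr_ge0 ?subr_ge0// ltW.
have h2 : 0 <= (1 - t) * (1 + x ord0 i) by rewrite mulr_ge0 ?subr_ge0//; lra.
have h3 : 0 < t * (1 - y ord0 i) by rewrite mulr_gt0 ?subr_gt0.
have h4 : 0 < t * (1 + y ord0 i) by rewrite mulr_gt0//; lra.
by apply/andP; split; lra.
Qed.

(** Lattice counts are meaningful for bounded sets only: fset_set sends an
infinite set to the empty one. *)
Lemma finite_lattice S : coord_bounded S -> finite_set (S `&` integer_lattice R n).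
Proof.
move=> [M hM]; pose N := `|Num.floor M|%N.
pose f (u : {ffun 'I_n -> 'I_(N + N).+1}) : vec := \row_i ((u i)%:R - N%:R).
apply: (@sub_finite_set _ _ (range f)); last exact: finite_image.
move=> w [Sw [z _ zw]]; have zM := hM w Sw; subst w.
have zN i : (`|z ord0 i| <= N)%N.
  have : `|z ord0 i|%:~R <= M by have := zM i; rewrite mxE intr_norm.
  rewrite -floor_ge_int => h; rewrite /N.
  by have := le_trans h (ler_norm _); rewrite -!abszE lez_nat.
pose m i : nat := `|(z ord0 i + N%:Z)%R|%N.
have mE i : (m i)%:Z = z ord0 i + N%:Z by have := zN i; rewrite /m; lia.
exists [ffun i => inord (m i)] => //.
apply/rowP => i; rewrite !mxE ffunE inordK; last by have := zN i; have := mE i; lia.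
by rewrite -[(m i)%:R]/((m i)%:Z%:~R) mE intrD addrK.
Qed.

Lemma lattice_countE S L : coord_bounded L ->
  lattice_count (L `&` S) =
  (\sum_(z <- fset_set (L `&` integer_lattice R n)) (z \in S))%N.
Proof.
move=> /finite_lattice fL; rewrite /lattice_count.
rewrite (_ : L `&` S `&` integer_lattice R n =
  (L `&` integer_lattice R n) `&` S); last by rewrite setIAC.
set F := fset_set _; set G := fset_set _.
have -> : F = [fset z in G | z \in S]%fset.
  apply/fsetP => z; rewrite !inE /= in_fset_set; last exact: finite_setIl.
  by rewrite in_fset_set// in_setI.
rewrite card_fset_sum1 big_fset/= big_mkcond; apply: eq_bigr => z _; by case: ifP.
Qed.

Lemma lattice_count_gt0 L : coord_bounded L -> L 0 -> (0 < lattice_count L)%N.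
Proof.
move=> /finite_lattice fL L0; rewrite cardfs_gt0; apply/fset0Pn; exists 0.
rewrite in_fset_set// inE; split=> //; exists 0 => //.
by apply/rowP => i; rewrite !mxE.
Qed.

Lemma translateP x L z : translate x L z <-> L (z - x).
Proof.
split=> [[y Ly <-]|h]; first by rewrite addrAC subrr add0r.
by exists (z - x) => //; rewrite addrC subrK.
Qed.

Lemma translate0 L : translate 0 L = L.
Proof. by apply/seteqP; split=> z; rewrite translateP subr0. Qed.

Lemma covariogram0 L : discrete_covariogram L 0 = (lattice_count L)%:R.
Proof. by rewrite /discrete_covariogram translate0 setIid. Qed.

(** Along a ray the covariogram is a finite sum of indicators of the sets of r
with z - r x in L, which are intervals since L is convex. *)
Lemma measurable_covariogram L x : coord_bounded L -> segment_closed L ->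
  measurable_fun setT (fun r : R => discrete_covariogram L (r *: x)).
Proof.
move=> bL cL; rewrite (_ : (fun r => _) = (fun r : R =>
    \sum_(z <- fset_set (L `&` integer_lattice R n)) \1_[set r | L (z - r *: x)] r)).
  apply: measurable_sum => z; apply: measurable_indic.
  apply: is_interval_measurable => r s /= Lr Ls t /andP[rt ts].
  have [rs|rs] := eqVneq r s.
    by rewrite -(_ : r = t)//; apply/eqP; rewrite eq_le rt rs ts.
  have rs' : r < s by rewrite lt_neqAle rs (le_trans rt).
  have := cL _ _ ((t - r) / (s - r)) _ Lr Ls.
  set w := (t - r) / (s - r).
  have hw : t = (1 - w) * r + w * s by rewrite /w; field; lra.
  have -> : (1 - w) *: (z - r *: x) + w *: (z - s *: x) = z - t *: x.
    rewrite hw; apply/rowP => i; rewrite !mxE; ring.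
  apply; rewrite /w divr_ge0 ?subr_ge0// ?(ltW rs')//=.
  by rewrite ler_pdivrMr ?subr_gt0// mul1r lerD2r.
apply/funext => r; rewrite /discrete_covariogram lattice_countE// natr_sum.
apply: eq_bigr => z _; rewrite indicE; congr (nat_of_bool _)%:R.
by apply/idP/idP; rewrite !inE translateP.
Qed.

(** For t = 0 and t = 1 the scaled cubes degenerate, and the inequality is the
monotonicity of the lattice count. *)
Lemma covariogram_concave K (t r a b : R) x : (0 < n)%N -> coord_bounded K ->
  segment_closed K -> K 0 -> 0 <= t <= 1 -> 0 <= a -> 0 <= b ->
  0 < discrete_covariogram K (r *: x) ->
  a ^+ n = discrete_covariogram K 0 -> b ^+ n = discrete_covariogram K (r *: x) ->
  ((1 - t) * a + t * b) ^+ n <=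
  discrete_covariogram (minkowski_sum K (open_cube R n)) ((t * r) *: x).
Proof.
move=> n0 bK cK K0 /andP[t0 t1] a0 b0 gr ha hb.
have bC := minkowski_coord_bounded bK open_cube_coord_bounded.
have subC S : S `<=` minkowski_sum S (open_cube R n).
  by move=> y Sy; exists y => //; exists 0; rewrite ?addr0// => i; rewrite mxE ltr01 ltrN10.
have fin S L : coord_bounded L -> finite_set (L `&` S `&` integer_lattice R n).
  by move=> bL; rewrite setIAC; apply: finite_setIl; exact: finite_lattice.
have mono S T L : coord_bounded L -> S `<=` L `&` T ->
    (lattice_count S <= lattice_count (L `&` T))%N.
  move=> bL ST; apply: fsubset_leq_card.
  rewrite -fset_set_sub; [exact: setSI| |exact: fin].
  by apply: sub_finite_set (fin T L bL); exact: setSI.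
have trans S T y : S `<=` T -> translate y S `<=` translate y T.
  by move=> ST z /translateP/ST/translateP.
have [t0'|t0'] := eqVneq t 0.
  rewrite t0' subr0 !mul0r addr0 mul1r ha scale0r /discrete_covariogram ler_nat.
  by apply: mono => //; apply: setISS => //; exact: trans.
have [t1'|t1'] := eqVneq t 1.
  rewrite t1' subrr mul0r add0r !mul1r hb /discrete_covariogram ler_nat.
  by apply: mono => //; apply: setISS => //; exact: trans.
apply: (@brunn_minkowski_lattice R n n0 K (K `&` translate (r *: x) K)).
- by rewrite lt_neqAle eq_sym t0' t0/= lt_neqAle t1'.
- exact: finite_lattice.
- exact: fin.
- exact: fin.
- exact: lattice_count_gt0.
- by move: gr; rewrite ltr0n.
- move=> y z e Ky [Kz /translateP Kz'] he; split.
    by exists ((1 - t) *: y + t *: z); [apply: cK; rewrite ?t0|exists e].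
  apply/translateP; exists ((1 - t) *: y + t *: (z - r *: x)).
    by apply: cK; rewrite ?t0.
  exists e => //; apply/rowP => i; rewrite !mxE; ring.
- by [].
- by [].
- by rewrite ha covariogram0.
- by [].
Qed.
End covariogram.

(** * Scaling of integrals over the half-line *)

Section scaling.
Variable R : realType.
Notation mu := (@lebesgue_measure R).
Local Open Scope ereal_scope.

Lemma lebesgue_measure_scale (c : {nonneg R}) (A : set R) : (0 < c%:num)%R ->
  measurable (A : set (measurableTypeR R)) ->
  pushforward (mscale c mu) (( *%R c%:num : R -> R) : _ -> measurableTypeR R) A = mu A.
Proof.
move=> c0 mA; apply/esym/lebesgue_measure_unique => //=.
move=> _ [[a b]] _ <-.
rewrite /pushforward /mscale/=.
rewrite (_ : _ @^-1` _ = `]a / c%:num, b / c%:num]%classic)%R; last first.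
  by apply/seteqP; split => x /=; rewrite !in_itv/= ltr_pdivrMr// ler_pdivlMr// mulrC.
rewrite !lebesgue_measure_itv/= !lte_fin ltr_pM2r ?invr_gt0//.
case: ifP => _; rewrite ?mule0// -!EFinB -EFinM; congr EFin.
by field; rewrite gt_eqF.
Qed.

Lemma integral_scale (c : R) (f : R -> \bar R) : (0 < c)%R ->
  measurable_fun setT f -> (forall r, 0 <= f r) ->
  c%:E * \int[mu]_(r in `[0%R, +oo[) f (c * r)%R = \int[mu]_(r in `[0%R, +oo[) f r.
Proof.
move=> c0 mf f0; pose c' := NngNum (ltW c0).
have mphi : measurable_fun setT (( *%R c : R -> R) : measurableTypeR R -> measurableTypeR R).
  exact: measurable_funM.
rewrite -(@ge0_integral_mscale _ _ _ mu `[0%R, +oo[ _ c' (f \o *%R c)); [|by []|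
  |by move=> r _; exact: f0]; last first.
  by apply: measurable_funTS; exact: (measurableT_comp mf mphi).
have {1}-> : `[0%R, +oo[%classic =
    (( *%R c : R -> R) : _ -> measurableTypeR R) @^-1` `[0%R, +oo[.
  by apply/seteqP; split => x /=; rewrite !in_itv/= !andbT pmulr_rge0.
rewrite -(@ge0_integral_pushforward _ _ _ _ _ _ mphi (mscale c' mu)
  `[0%R, +oo[ f)//; last first.
  exact: measurable_funTS mf.
apply: eq_measure_integral => A mA _.
exact: lebesgue_measure_scale.
Qed.

End scaling.

(** * Beta integrals *)

Section beta.
Variable R : realType.
Notation mu := (@lebesgue_measure R).

(** The generalized binomial coefficient binom(n + p, n); see gbinomE. *)
Definition rbinom (n : nat) (p : R) : R := \prod_(k < n) ((p + k.+1%:R) / k.+1%:R).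

Lemma rbinom_gt0 n p : 0 < p -> 0 < rbinom n p.
Proof. by move=> p0; apply: prodr_gt0 => i _; rewrite divr_gt0// addr_gt0. Qed.

Lemma rbinomS n p : rbinom n.+1 p = rbinom n p * ((p + n.+1%:R) / n.+1%:R).
Proof. by rewrite /rbinom big_ord_recr. Qed.

Lemma rbinom_shift n p : 0 < p -> (p + 1) * rbinom n (p + 1) = rbinom n p * (p + n.+1%:R).
Proof.
move=> p0; elim: n => [|n IH]; first by rewrite /rbinom !big_ord0 mulr1 mul1r.
rewrite !rbinomS (mulrA (p + 1)) IH -[n.+2%:R]natr1.
by field; have := ler0n R n; lra.
Qed.

Lemma continuous_powR (p : R) (x : R) : 0 < x -> {for x, continuous (fun y : R => y `^ p)}.
Proof.
move=> x0; apply/differentiable_continuous/derivable1_diffP/derivable_powR.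
by rewrite in_itv/= x0.
Qed.

(** For p < 1 the integrand is unbounded at 0: integrate over [1/(k+2), 1] and
let k tend to infinity. *)
Lemma integral_powR01 (p : R) : 0 < p ->
  (\int[mu]_(r in `[0%R, 1%R]) (r `^ (p - 1))%:E = (p^-1)%:E)%E.
Proof.
move=> p0.
have mf (D : set R) : measurable_fun D (fun r : R => (r `^ (p - 1))%:E).
  by apply/measurable_EFinP; apply: measurable_funTS; exact: measurable_powR.
rewrite -integral_itv_obnd_cbnd//.
pose F (k : nat) := `[(k.+2%:R^-1 : R), 1%R]%classic.
have FU : \bigcup_k F k = `]0%R, 1%R]%classic.
  apply/seteqP; split => [x [k _]|x]; rewrite /F /= !in_itv/=.
    by move=> /andP[h ->]; rewrite andbT; apply: lt_le_trans h; rewrite invr_gt0.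
  move=> /andP[x0 x1]; pose N := (Num.trunc x^-1).
  have xV : x^-1 < N.+1%:R by rewrite truncnS_gt.
  exists N => //=; rewrite in_itv/= x1 andbT.
  rewrite -[leRHS]invrK lef_pV2 ?posrE ?invr_gt0//.
  by apply: (le_trans (ltW xV)); rewrite ler_nat.
have F_mono : {homo F : n m / (n <= m)%N >-> (n <= m)%O}.
  move=> i j ij; apply/subsetPset => x; rewrite /F/= !in_itv/= => /andP[h ->].
  by rewrite andbT; apply: le_trans h; rewrite lef_pV2 ?posrE// ler_nat !ltnS.
have := @ge0_nondecreasing_set_cvg_integral _ (measurableTypeR R) _ F
  (fun r : R => (r `^ (p - 1))%:E) mu
  F_mono (fun i => measurable_itv _) (fun i => mf _) (fun i x _ => powR_ge0 _ _).
rewrite FU => cv; apply: (cvg_unique _ cv) => //=.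
rewrite (_ : (fun i => _) = (fun k => ((1 - (k.+2%:R^-1 : R) `^ p) / p)%:E)); last first.
  apply/funext => k.
  have k1 : (k.+2%:R^-1 : R) < 1 by rewrite invf_lt1// ltr1n.
  rewrite (@continuous_FTC2 _ _ (fun r : R => r `^ p / p))//.
  - by rewrite -EFinB powR1 -mulrBl.
  - apply: continuous_in_subspaceT => x; rewrite inE/= in_itv/= => /andP[x1 _].
    by apply: continuous_powR; apply: lt_le_trans x1; rewrite invr_gt0.
  - have cF (x : R) : 0 < x -> {for x, continuous (fun r : R => r `^ p / p)}.
      by move=> x0; apply: cvgMr_tmp; exact: continuous_powR.
    split.
    + move=> x; rewrite in_itv/= => /andP[x1 _].
      apply: derivableM => //; apply: derivable_powR; rewrite in_itv/= andbT.
      by apply: lt_trans x1; rewrite invr_gt0.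
    + by apply: cvg_at_right_filter; apply: cF; rewrite invr_gt0.
    + by apply: cvg_at_left_filter; apply: cF.
  - move=> x; rewrite in_itv/= => /andP[x1 _].
    have x0 : 0 < x by apply: lt_trans x1; rewrite invr_gt0.
    have xI : x \in `]0, +oo[ by rewrite in_itv/= x0.
    rewrite derive1E deriveM//; last exact: derivable_powR.
    rewrite derive_cst scaler0 add0r -derive1E powR_derive1//.
    by rewrite /GRing.scale/=; field; rewrite gt_eqF.
apply: (@cvg_EFin _ _ _ eventually_filter); first exact: nearW.
rewrite (_ : _ \o _ = (fun k => (1 - (k.+2%:R^-1 : R) `^ p) * p^-1))//.
rewrite -[X in _ --> X]mul1r -[X in X * p^-1](subr0 1).
apply: cvgM; last exact: cvg_cst.
apply: cvgB; first exact: cvg_cst.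
have /cvg_at_rightP := @powR_cvg0 R p p0; apply.
split=> //.
have := @cvg_harmonic R; rewrite -cvg_shiftS; exact.
Qed.

Lemma measurable_beta_integrand (n : nat) (p : R) (D : set R) :
  measurable_fun D (fun r : R => (r `^ (p - 1) * (1 - r) ^+ n)%:E).
Proof.
apply/measurable_EFinP/measurable_funM.
  by apply: measurable_funTS; exact: measurable_powR.
by apply/measurable_funX/measurable_funB => //; exact: measurable_cst.
Qed.

(** Induction on n through
r^(p-1) (1-r)^n = r^(p-1) (1-r)^(n+1) + r^p (1-r)^n, which gives the integral
for n + 1 as a difference of two integrals for n. *)
Lemma integral_beta (n : nat) (p : R) : 0 < p ->
  (\int[mu]_(r in `[0%R, 1%R]) (r `^ (p - 1) * (1 - r) ^+ n)%:E =
   ((p * rbinom n p)^-1)%:E)%E.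
Proof.
elim: n p => [|n IH] p p0.
  rewrite /rbinom big_ord0 mulr1 -integral_powR01//.
  by apply: eq_integral => r _; rewrite expr0 mulr1.
have p1 : 0 < p + 1 by rewrite addr_gt0.
have := IH p p0.
have ge0 (m : nat) (s r : R) : `[0, 1]%classic r ->
    (0 <= (r `^ (s - 1) * (1 - r) ^+ m)%:E)%E.
  rewrite /= in_itv/= => /andP[r0 r1].
  by rewrite lee_fin mulr_ge0 ?powR_ge0 ?exprn_ge0// subr_ge0.
have -> : (\int[mu]_(r in `[0%R, 1%R]) (r `^ (p - 1) * (1 - r) ^+ n)%:E =
    \int[mu]_(r in `[0%R, 1%R]) ((r `^ (p - 1) * (1 - r) ^+ n.+1)%:E +
    (r `^ (p + 1 - 1) * (1 - r) ^+ n)%:E))%E.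
  apply: eq_integral => r; rewrite inE/= in_itv/= => /andP[r0 r1].
  by rewrite -EFinD addrK -(mulr_powRB1 r0 p0) exprS; congr EFin; ring.
rewrite ge0_integralD//=; last 4 first.
- by move=> r /ge0.
- exact: measurable_beta_integrand.
- by move=> r /ge0.
- exact: measurable_beta_integrand.
rewrite (IH _ p1) => E.
rewrite -[LHS](@addeK _ ((p + 1) * rbinom n (p + 1))^-1%:E)// E -EFinB; congr EFin.
rewrite rbinom_shift// rbinomS.
have B0 := rbinom_gt0 n p0.
field; rewrite !gt_eqF//=; have := ler0n R n; lra.
Qed.
End beta.

(** * Moments of tents *)

Section tent.
Variable R : realType.
Notation mu := (@lebesgue_measure R).

Definition tent (a r : R) : R := Num.max 0 (1 - r / a).

Lemma tent_ge0 a r : 0 <= tent a r.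
Proof. by rewrite le_max lexx. Qed.

Lemma measurable_tent (n : nat) (a : R) (D : set R) :
  measurable_fun D (fun r => tent a r ^+ n).
Proof.
apply/measurable_funX/measurable_maxr; first exact: measurable_cst.
apply: measurable_funB; first exact: measurable_cst.
by apply: measurable_funM => //; exact: measurable_cst.
Qed.

(** The condition 0 < n is essential: for n = 0 the power of the tent is the
constant 1, with infinite moments. *)
Lemma integral_tent (n : nat) (p a : R) : (0 < n)%N -> 0 < p -> 0 < a ->
  (\int[mu]_(r in `[0%R, +oo[) (r `^ (p - 1) * tent a r ^+ n)%:E =
   (a `^ p / (p * rbinom n p))%:E)%E.
Proof.
move=> n0 p0 a0; have aV0 : 0 < a^-1 by rewrite invr_gt0.
pose f (s : R) := (s `^ (p - 1) * tent 1 s ^+ n)%:E.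
have mf : measurable_fun setT f.
  apply/measurable_EFinP/measurable_funM; first exact: measurable_powR.
  exact: measurable_tent.
have f0 r : (0 <= f r)%E by rewrite lee_fin mulr_ge0 ?powR_ge0 ?exprn_ge0 ?tent_ge0.
have If : (\int[mu]_(r in `[0%R, +oo[) f r = ((p * rbinom n p)^-1)%:E)%E.
  rewrite -integral_beta//.
  have -> : `[0%R, 1%R]%classic = `[0, +oo[%classic `&` `[0%R, 1%R]%classic :> set R.
    by apply/seteqP; split=> x /=; rewrite !in_itv/= ?andbT; [move=> /andP[-> ->]|case].
  rewrite integral_mkcondr; apply: eq_integral => r; rewrite inE/= in_itv/= andbT => r0.
  rewrite patchE mem_setE in_itv/= r0/= /f /tent divr1; case: (leP r 1) => r1.
    by rewrite (max_idPr _)// subr_ge0.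
  rewrite (max_idPl _) ?expr0n ?gtn_eqF ?mulr0//.
  by rewrite subr_le0 ltW.
have := integral_scale aV0 mf f0; rewrite If.
have -> : (\int[mu]_(r in `[0%R, +oo[) f (a^-1 * r)%R =
   \int[mu]_(r in `[0%R, +oo[)
     ((a^-1 `^ (p - 1))%:E * (r `^ (p - 1) * tent a r ^+ n)%:E))%E.
  apply: eq_integral => r; rewrite inE/= in_itv/= andbT => r0.
  rewrite -EFinM /f powRM ?(ltW aV0)// -mulrA; congr (_ * (_ * _ ^+ _))%:E.
  by rewrite /tent divr1 mulrC.
rewrite ge0_integralZl//=; last 3 first.
- by apply/measurable_EFinP/measurable_funM;
    [apply: measurable_funTS; exact: measurable_powR|exact: measurable_tent].
- by move=> r _; rewrite lee_fin mulr_ge0 ?powR_ge0 ?exprn_ge0 ?tent_ge0.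
- by rewrite lee_fin powR_ge0.
rewrite muleA -EFinM mulr_powRB1 ?(ltW aV0)// => E.
rewrite EFinM -E muleA -EFinM -powRM ?(ltW aV0) ?(ltW a0)// divff ?gt_eqF// powR1 mul1e.
by [].
Qed.
End tent.

(** * The Gamma function *)

Section gamma.
Variable R : realType.
Notation mu := (@lebesgue_measure R).

(** The extended-real integral behind Gamma; the functional equation holds for it
before finiteness is known. *)
Definition gamma_int (x : R) : \bar R :=
  (\int[mu]_(t in `[0%R, +oo[) (t `^ (x - 1) * expR (- t))%:E)%E.

Lemma within_continuous_powR (y N : R) : 0 <= y -> 0 < N ->
  {within `[0, N], continuous (fun t : R => t `^ y)}.
Proof.
move=> y0 N0; apply/continuous_within_itvP => //; split.
- by move=> t; rewrite in_itv/= => /andP[t0 _]; exact: continuous_powR.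
- move: y0; rewrite le_eqVlt => /predU1P[<-|y0].
    rewrite powRr0 (_ : (fun t => _) = cst 1); first exact: cvg_cst.
    by apply/funext => t; rewrite powRr0.
  by rewrite powR0 ?gt_eqF//; exact: powR_cvg0.
- by apply: cvg_at_left_filter; exact: continuous_powR.
Qed.

Lemma measurable_gamma_integrand (x : R) (D : set R) :
  measurable_fun D (fun t : R => (t `^ (x - 1) * expR (- t))%:E).
Proof.
apply/measurable_EFinP/measurable_funM.
  by apply: measurable_funTS; exact: measurable_powR.
by apply: measurable_funTS; apply: measurableT_comp => //; exact: measurable_expR.
Qed.

Lemma gamma_integrand_ge0 (x t : R) : (0 <= (t `^ (x - 1) * expR (- t))%:E)%E.
Proof. by rewrite lee_fin mulr_ge0 ?powR_ge0 ?expR_ge0. Qed.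

(** Raise t / (2 y) <= exp (t / (2 y)) to the power y. *)
Lemma powR_le_expR (y t : R) : 0 < y -> 0 <= t ->
  t `^ y <= (2 * y) `^ y * expR (t / 2).
Proof.
move=> y0 t0; have y2 : 0 < 2 * y by rewrite mulr_gt0.
have {1}-> : t = (2 * y) * (t / (2 * y)) by field; rewrite gt_eqF.
rewrite powRM ?divr_ge0// ?(ltW y2)// ler_pM2l ?powR_gt0//.
have -> : expR (t / 2) = expR (t / (2 * y)) `^ y.
  by rewrite -expRM; congr expR; field; rewrite gt_eqF.
apply: ge0_ler_powR; rewrite ?nnegrE ?expR_ge0 ?divr_ge0// ?(ltW y0) ?(ltW y2)//.
by apply: le_trans (expR_ge1Dx _); rewrite lerDr.
Qed.

Lemma integral_expRN : (\int[mu]_(t in `[0%R, +oo[) (expR (- t))%:E = 1)%E.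
Proof.
have cE : continuous (fun t : R => expR (- t)).
  by move=> x; apply: (@continuous_comp _ _ _ (fun t : R => - t) expR);
    [exact: continuousN|exact: continuous_expR].
rewrite (@ge0_continuous_FTC2y _ _ (fun t => - expR (- t)) 0 0).
- by rewrite oppr0 expR0 EFinN oppeK add0e.
- by move=> t _; exact: expR_ge0.
- exact: continuous_subspaceT.
- by rewrite -oppr0; apply: cvgN; exact: cvgr_expR.
- by move=> t _; exact: ex_derive.
- by apply: cvg_at_right_filter; apply: cvgN; apply: cE.
- move=> t _; rewrite derive1E derive_val /GRing.scale/=; ring.
Qed.

Lemma gamma_int1 : gamma_int 1 = 1%E.
Proof.
rewrite -integral_expRN; apply: eq_integral => t _.
by rewrite subrr powRr0 mul1r.
Qed.

(** By powR_le_expR the integrand is at most a constant times exp (- t / 2). *)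
Lemma gamma_int_lty (x : R) : 1 < x -> (gamma_int x < +oo)%E.
Proof.
move=> x1; have x0 : 0 < x - 1 by rewrite subr_gt0.
pose C := (2 * (x - 1)) `^ (x - 1).
have mE (D : set R) : measurable_fun D (fun t : R => (expR (- t))%:E).
  apply/measurable_EFinP; apply: measurable_funTS.
  by apply: measurableT_comp => //; exact: measurable_expR.
have mE2 (D : set R) : measurable_fun D (fun t : R => (expR (- (2^-1 * t)))%:E).
  by apply/measurable_EFinP; apply: measurable_funTS; apply: measurableT_comp;
    [exact: measurable_expR|apply: measurable_funN; apply: measurable_funM].
have half : (\int[mu]_(t in `[0%R, +oo[) (expR (- (2^-1 * t)))%:E < +oo)%E.
  have half0 : 0 < 2^-1 :> R by rewrite invr_gt0.
  have := @integral_scale R 2^-1 (fun t => (expR (- t))%:E) half0 (mE _)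
    (fun r => expR_ge0 _).
  rewrite integral_expRN ltey; case: eqP => // ->.
  by rewrite gt0_muley// lte_fin invr_gt0.
apply: (@le_lt_trans _ _
  (C%:E * \int[mu]_(t in `[0%R, +oo[) (expR (- (2^-1 * t)))%:E)%E); last first.
  by rewrite lte_mul_pinfty// lee_fin powR_ge0.
rewrite -ge0_integralZl//=; last 2 first.
- exact: mE2.
- by rewrite lee_fin powR_ge0.
apply: ge0_le_integral => //=.
- by move=> t _; exact: gamma_integrand_ge0.
- exact: measurable_gamma_integrand.
- by apply: measurable_funeM; exact: mE2.
- move=> t; rewrite in_itv/= andbT => t0; rewrite lee_fin.
  have := powR_le_expR x0 t0; rewrite -/C => h.
  have -> : expR (- (2^-1 * t)) = expR (t / 2) * expR (- t).
    by rewrite -expRD; congr expR; field.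
  by rewrite mulrA ler_wpM2r ?expR_ge0.
Qed.

Lemma gamma_int_gt0 (x : R) : 1 <= x -> (0 < gamma_int x)%E.
Proof.
move=> x1; apply: (@lt_le_trans _ _ (\int[mu]_(t in `[1%R, 2%R]) (expR (- 2))%:E)%E).
  rewrite integral_cst//= lebesgue_measure_itv/= lte_fin ltr1n/= -EFinB -EFinM lte_fin.
  by rewrite mulr_gt0 ?expR_gt0// subr_gt0 ltr1n.
apply: (@le_trans _ _ (\int[mu]_(t in `[1%R, 2%R]) (t `^ (x - 1) * expR (- t))%:E)%E).
  apply: ge0_le_integral => //=.
  - exact: measurable_gamma_integrand.
  - move=> t; rewrite in_itv/= => /andP[t1 t2]; rewrite lee_fin.
    rewrite -[leLHS]mul1r; apply: ler_pM; rewrite ?expR_ge0//.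
      by rewrite -[leLHS](powRr0 t); apply: ler_powR; rewrite ?subr_ge0.
    by rewrite ler_expR lerN2.
apply: ge0_subset_integral => //=.
- exact: measurable_gamma_integrand.
- by move=> t _; exact: gamma_integrand_ge0.
- by move=> t /=; rewrite !in_itv/= andbT => /andP[t1 _]; apply: le_trans t1.
Qed.

(** Integration by parts on [0, k+1], letting k tend to infinity. For x >= 1 the
integrands are continuous up to 0. *)
Lemma gamma_intS (x : R) : 1 <= x -> gamma_int (x + 1) = (x%:E * gamma_int x)%E.
Proof.
move=> x1; have x0 : 0 < x by apply: lt_le_trans x1.
pose F (k : nat) := `[(0 : R), k.+1%:R]%classic.
have FU : \bigcup_k F k = `[0%R, +oo[%classic.
  apply/seteqP; split => [t [k _]|t]; rewrite /F /= !in_itv/= andbT; first by case/andP.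
  move=> t0; exists (Num.trunc t) => //=; rewrite in_itv/= t0/=.
  by rewrite ltW// truncnS_gt.
have F_mono : {homo F : n m / (n <= m)%N >-> (n <= m)%O}.
  move=> i j ij; apply/subsetPset => t; rewrite /F/= !in_itv/= => /andP[-> h].
  by apply: le_trans h _; rewrite ler_nat ltnS.
have cv y := @ge0_nondecreasing_set_cvg_integral _ (measurableTypeR R) _ F
  (fun t : R => (t `^ (y - 1) * expR (- t))%:E) mu
  F_mono (fun i => measurable_itv _) (fun i => @measurable_gamma_integrand y (F i))
  (fun i t _ => gamma_integrand_ge0 y t).
rewrite FU in cv.
have parts (k : nat) : (x%:E * \int[mu]_(t in F k) (t `^ (x - 1) * expR (- t))%:E =
   (k.+1%:R `^ x * expR (- k.+1%:R))%:E +
   \int[mu]_(t in F k) (t `^ (x + 1 - 1) * expR (- t))%:E)%E.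
  rewrite addrK /F; have N0 : 0 < k.+1%:R :> R by [].
  have := @integration_by_parts R (fun t => t `^ x) (fun t => - expR (- t))
    (fun t => x * t `^ (x - 1)) (fun t => expR (- t)) 0 k.+1%:R N0.
  have cE : continuous (fun t : R => expR (- t)).
    by move=> u; apply: (@continuous_comp _ _ _ (fun t : R => - t) expR);
      [exact: continuousN|exact: continuous_expR].
  rewrite /= powR0 ?gt_eqF// mul0r subr0 => ->; first last.
  - by move=> t _; rewrite derive1E derive_val /GRing.scale/=; ring.
  - split; first by move=> t _; exact: ex_derive.
    + by apply: cvg_at_right_filter; apply: cvgN; apply: cE.
    + by apply: cvg_at_left_filter; apply: cvgN; apply: cE.
  - exact: continuous_subspaceT.
  - move=> t; rewrite in_itv/= => /andP[t0 _]; rewrite powR_derive1//.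
    by rewrite in_itv/= t0.
  - have /continuous_within_itvP := @within_continuous_powR x k.+1%:R (ltW x0) N0.
    move=> /(_ N0)[c1 c2 c3]; split=> // t; rewrite in_itv/= => /andP[t0 _].
    by apply: derivable_powR; rewrite in_itv/= t0.
  - move=> t; apply: cvgM; first exact: cvg_cst.
    by apply: within_continuous_powR => //; rewrite subr_ge0.
  have int : mu.-integrable `[0, k.+1%:R] (fun t : R => (t `^ (x - 1) * expR (- t))%:E).
    apply: continuous_compact_integrable; first exact: segment_compact.
    move=> t; apply: cvgM; first by apply: within_continuous_powR; rewrite ?subr_ge0.
    by apply: continuous_subspaceT; exact: cE.
  have -> : (\int[mu]_(t in `[0%R, k.+1%:R]) (x * t `^ (x - 1) * - expR (- t))%:E =
      (- x)%:E * \int[mu]_(t in `[0%R, k.+1%:R]) (t `^ (x - 1) * expR (- t))%:E)%E.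
    rewrite -integralZl//; apply: eq_integral => t _.
    by rewrite -EFinM; congr EFin; ring.
  by rewrite EFinN mulNe oppeK addeA -EFinD mulrN subrr add0e.
have : ((x%:E * \int[mu]_(t in F k) (t `^ (x - 1) * expR (- t))%:E)%E @[k --> \oo] -->
   (x%:E * gamma_int x)%E).
  by apply: cvgeZl => //; exact: cv.
under eq_fun do rewrite parts.
have : ((k.+1%:R `^ x * expR (- k.+1%:R))%:E +
   \int[mu]_(t in F k) (t `^ (x + 1 - 1) * expR (- t))%:E)%E @[k --> \oo] -->
   (0%:E + gamma_int (x + 1))%E.
  apply: cvgeD; last exact: cv.
    rewrite ge0_adde_def//= inE// integral_ge0// => t _; exact: gamma_integrand_ge0.
  apply: (@cvg_EFin _ _ _ eventually_filter); first exact: nearW.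
  rewrite (_ : _ \o _ = (fun k => k.+1%:R `^ x * expR (- k.+1%:R)))//.
  pose C := (2 * x) `^ x.
  have h : (fun k : nat => (C * 2) * (k.+1%:R^-1 : R)) @ \oo --> (0 : R).
    rewrite -(mulr0 (C * 2)); apply: cvgM; first exact: cvg_cst.
    exact: cvg_harmonic.
  apply: (squeeze_cvgr _ (@cvg_cst _ _ _ _ _) h); apply: nearW => k.
  rewrite mulr_ge0 ?powR_ge0 ?expR_ge0//=.
  have k0 : 0 < k.+1%:R :> R by [].
  have := powR_le_expR x0 (ltW k0); rewrite -/C => hk.
  have -> : expR (- k.+1%:R) = (expR (k.+1%:R / 2))^-1 * (expR (k.+1%:R / 2))^-1 :> R.
    by rewrite -!expRN -expRD; congr expR; field.
  have e0 : 0 < expR (k.+1%:R / 2) :> R by exact: expR_gt0.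
  have e1 : (expR (k.+1%:R / 2))^-1 <= 2 * (k.+1%:R^-1) :> R.
    have -> : 2 * k.+1%:R^-1 = (k.+1%:R / 2)^-1 :> R by rewrite invfM invrK mulrC.
    rewrite lef_pV2 ?posrE// ?divr_gt0//.
    by apply: le_trans (expR_ge1Dx _); rewrite lerDr.
  rewrite mulrA -[leRHS]mulrA; apply: ler_pM => //.
  - by rewrite ler_pdivrMr.
move=> c1 c2; rewrite -[LHS]add0e; exact: (cvg_unique _ c1 c2).
Qed.

Lemma GammaE (x : R) : (gamma_int x < +oo)%E -> (Gamma x)%:E = gamma_int x.
Proof.
move=> gy; rewrite /Gamma /Rintegral fineK// ge0_fin_numE//.
by apply: integral_ge0 => t _; exact: gamma_integrand_ge0.
Qed.

Lemma gamma_int_fin (x : R) : 1 <= x -> (gamma_int x < +oo)%E.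
Proof.
rewrite le_eqVlt => /predU1P[<-|]; last exact: gamma_int_lty.
by rewrite gamma_int1 ltry.
Qed.

Lemma Gamma_gt0 (x : R) : 1 <= x -> 0 < Gamma x.
Proof. by move=> x1; rewrite -lte_fin GammaE ?gamma_int_gt0 ?gamma_int_fin. Qed.

Lemma GammaS (x : R) : 1 <= x -> Gamma (x + 1) = x * Gamma x.
Proof.
move=> x1; apply: EFin_inj; rewrite EFinM !GammaE ?gamma_int_fin ?gamma_intS//.
by rewrite (le_trans x1)// lerDl.
Qed.

Lemma Gamma1 : Gamma (1 : R) = 1.
Proof. by apply: EFin_inj; rewrite GammaE ?gamma_int_fin// gamma_int1. Qed.

(** Both sides obey the same recursion in n, by the functional equation of
Gamma. *)
Lemma gbinomE n (p : R) : 0 < p -> gbinom n p = rbinom n p.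
Proof.
move=> p0; have p1 : 1 <= p + 1 by rewrite lerDr ltW.
have G0 := Gamma_gt0 p1.
rewrite /gbinom; elim: n => [|n IH].
  by rewrite !add0r Gamma1 mul1r divff ?gt_eqF// /rbinom big_ord0.
have h1 : 1 <= n%:R + 1 :> R by rewrite lerDr.
have h2 : 1 <= n%:R + p + 1 by rewrite lerDr addr_ge0 ?(ltW p0).
rewrite rbinomS -IH -[n.+1%:R]natr1.
have -> : n%:R + 1 + p + 1 = (n%:R + p + 1) + 1 by ring.
rewrite (GammaS h1) (GammaS h2).
have G1 := Gamma_gt0 h1; clear IH h1 h2.
move: (Gamma (n%:R + p + 1)) (Gamma (n%:R + 1)) (Gamma (p + 1)) G0 G1 => A B C G0 G1.
by field; rewrite (gt_eqF G0) (gt_eqF G1) /=; have := ler0n R n; lra.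
Qed.
End gamma.

(** * A Berwald-type inequality *)

Section berwald.
Variable R : realType.
Notation mu := (@lebesgue_measure R).
Variables (n : nat) (p q : R) (U V : R -> R).
Hypotheses (n0 : (0 < n)%N) (p0 : 0 < p) (pq : p < q).
Hypotheses (mU : measurable_fun setT U) (mV : measurable_fun setT V).
Hypotheses (U0 : forall r, 0 <= U r) (V0 : forall r, 0 <= V r).
(* u stands for the n-th root of U r. With U 0 = 1 in mind this is the concavity
   of the n-th roots between 0 and r, with V in place of U at the middle
   point. *)
Hypothesis UV : forall r t u : R, 0 < r -> 0 <= t <= 1 -> 0 < U r ->
  0 <= u -> u ^+ n = U r -> (1 - t + t * u) ^+ n <= V (t * r).

Let q0 : 0 < q. Proof. exact: lt_trans pq. Qed.

Definition moment (s : R) (f : R -> R) : \bar R :=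
  (\int[mu]_(r in `[0%R, +oo[) (r `^ (s - 1) * f r)%:E)%E.

Lemma measurable_moment (s : R) (f : R -> R) (D : set R) :
  measurable_fun setT f -> measurable_fun D (fun r : R => (r `^ (s - 1) * f r)%:E).
Proof.
move=> mf; apply/measurable_EFinP/measurable_funM; last exact: measurable_funTS.
by apply: measurable_funTS; exact: measurable_powR.
Qed.

(** Removing the origin avoids the values of the integrands there. *)
Lemma moment_oy (s : R) (f : R -> R) : measurable_fun setT f ->
  moment s f = (\int[mu]_(r in `]0%R, +oo[) (r `^ (s - 1) * f r)%:E)%E.
Proof.
move=> mf; rewrite /moment -integral_itv_obnd_cbnd//.
exact: measurable_moment.
Qed.

Lemma le_moment (s : R) (f g : R -> R) :
  measurable_fun setT f -> measurable_fun setT g ->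
  (forall r, 0 <= f r) -> (forall r, 0 < r -> f r <= g r) ->
  (moment s f <= moment s g)%E.
Proof.
move=> mf mg f0 fg; rewrite !moment_oy//; apply: ge0_le_integral => //=.
- by move=> r _; rewrite lee_fin mulr_ge0 ?powR_ge0.
- exact: measurable_moment.
- exact: measurable_moment.
- move=> r; rewrite in_itv/= andbT => r0.
  by rewrite lee_fin ler_wpM2l ?powR_ge0 ?fg.
Qed.

Lemma domination r : 0 < r -> U r <= V r.
Proof.
move=> r0; have := U0 r; rewrite le_eqVlt => /predU1P[<-//|Ur].
have [u [u0 un]] := nonneg_root n0 (ltW Ur).
by have := UV r0 (t := 1) _ Ur u0 un; rewrite subrr add0r !mul1r un ler01 lexx; apply.
Qed.

(** If U r lies above the tent, the segment from 1 at 0 to the n-th root of U r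
lies above the tent on [0, r], and V lies above the segment. *)
Lemma tent_below (a r s : R) : 0 < a -> 0 < r -> 0 < U r -> tent a r ^+ n <= U r ->
  0 <= s <= r -> tent a s ^+ n <= V s.
Proof.
move=> a0 r0 Ur Lr /andP[s0 sr]; have [u [u0 un]] := nonneg_root n0 (ltW Ur).
have ur : 1 - r / a <= u.
  apply: (@le_trans _ _ (tent a r)); first by rewrite le_max lexx orbT.
  by rewrite -(@ler_pXn2r _ n)// ?nnegrE ?tent_ge0// un.
have t01 : 0 <= s / r <= 1 by rewrite divr_ge0 ?(ltW r0)//= ler_pdivrMr// mul1r.
have := UV r0 t01 Ur u0 un; rewrite divfK ?gt_eqF//; apply: le_trans.
case/andP: t01 => t0 t1.
have h0 : 0 <= 1 - s / r + s / r * u by rewrite addr_ge0 ?subr_ge0// mulr_ge0.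
rewrite ler_pXn2r// ?nnegrE ?tent_ge0// ge_max h0/=.
have -> : 1 - s / a = 1 - s / r + s / r * (1 - r / a).
  by field; rewrite !gt_eqF.
by rewrite lerD2l ler_wpM2l.
Qed.

(** The comparison described at the beginning. The strict inequality of the q-th
moments guarantees that U > 0 lies above the tent somewhere. *)
Lemma tent_moment_le (a : R) : 0 < a ->
  (moment q (fun r => (tent a r ^+ n)%R) < moment q U)%E ->
  (moment p (fun r => (tent a r ^+ n)%R) <= moment p V)%E.
Proof.
move=> a0 big; pose L (r : R) : R := tent a r ^+ n.
have mL : measurable_fun setT L by exact: measurable_tent.
have L0 r : 0 <= L r by rewrite exprn_ge0 ?tent_ge0.
pose S := [set r | [/\ 0 < r, 0 < U r & L r <= U r]].
have outS r : 0 < r -> ~ S r -> U r <= L r.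
  move=> r0 nS; have := U0 r; rewrite le_eqVlt => /predU1P[<-//|Ur].
  by rewrite leNgt; apply/negP => /ltW LU; apply: nS.
have S0 : S !=set0.
  apply/set0P/eqP => S0; move: big; apply/negP; rewrite -leNgt.
  by apply: le_moment => // r r0; apply: outS => //; rewrite S0.
have [ubS|nubS] := pselect (has_ubound S); last first.
  (* S reaches arbitrarily far, so V is above the tent everywhere. *)
  apply: le_moment => // r r0.
  have [s [Ss rs]] : exists s, S s /\ r <= s.
    apply: contra_notP nubS => /forallNP h; exists r => s Ss.
    by rewrite leNgt; apply/negP => rs; apply: (h s); split=> //; exact: ltW.
  by case: Ss => s0 Us Ls; apply: (tent_below a0 s0) => //; rewrite ltW.
have hS : has_sup S by [].
set T := sup S; have T0 : 0 < T.
  by case: S0 => s Ss; apply: lt_le_trans (ub_le_sup ubS Ss); case: Ss.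
have belowT r : 0 < r -> r < T -> L r <= V r.
  move=> r0 rT; have Tr0 : 0 < T - r by rewrite subr_gt0.
  have [s [s0 Us Ls]] := sup_adherent Tr0 hS.
  rewrite subKr => rs; apply: (tent_below a0 s0) => //.
  by rewrite (ltW r0) ltW.
have aboveT r : T < r -> U r <= L r.
  move=> Tr; apply: outS; first exact: lt_trans Tr.
  by move=> Sr; move: Tr; rewrite ltNge => /negP; apply; exact: ub_le_sup.
pose k := T `^ (p - q).
have k0 : 0 < k by rewrite powR_gt0.
(* With w = (r / T)^(q - p) this reads V - L >= w (U - L). *)
have pointwise r : 0 < r ->
    r `^ (p - 1) * L r + k * (r `^ (q - 1) * U r) <=
    r `^ (p - 1) * V r + k * (r `^ (q - 1) * L r).
  move=> r0; pose w := k * r `^ (q - p).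
  have w0 : 0 <= w by rewrite mulr_ge0 ?powR_ge0.
  have kw (x : R) : k * (r `^ (q - 1) * x) = r `^ (p - 1) * (w * x).
    have -> : q - 1 = (p - 1) + (q - p) by ring.
    by rewrite powRD ?(gt_eqF r0) ?implybT// /w; ring.
  rewrite !kw -!mulrDr ler_wpM2l ?powR_ge0//.
  have wE : w = (r / T) `^ (q - p).
    rewrite powRM ?(ltW r0) ?invr_ge0 ?(ltW T0)// -(powR_inv1 (ltW T0)).
    by rewrite -powRrM mulN1r opprB mulrC.
  have UVr := domination r0.
  have e1 : 1 `^ (q - p) = 1 :> R by rewrite powR1.
  have qp0 : 0 <= q - p by rewrite subr_ge0 ltW.
  have [rT|Tr|rT] := ltgtP r T.
  - have w1 : w <= 1.
      rewrite wE -[leRHS]e1; apply: ge0_ler_powR => //;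
        rewrite ?nnegrE ?divr_ge0 ?(ltW r0) ?(ltW T0)//.
      by rewrite ler_pdivrMr// mul1r ltW.
    have LV := belowT _ r0 rT; nra.
  - have w1 : 1 <= w.
      rewrite wE -[leLHS]e1; apply: ge0_ler_powR => //;
        rewrite ?nnegrE ?divr_ge0 ?(ltW r0) ?(ltW T0)//.
      by rewrite ler_pdivlMr// mul1r ltW.
    have UL := aboveT _ Tr; nra.
  - have -> : w = 1 by rewrite wE rT divff ?gt_eqF// powR1.
    by lra.
have mom0 s f : (forall r, 0 <= f r) -> forall r, (0 <= (r `^ (s - 1) * f r)%:E)%E.
  by move=> f0 r; rewrite lee_fin mulr_ge0 ?powR_ge0.
have I : (moment p L + k%:E * moment q U <= moment p V + k%:E * moment q L)%E.
  rewrite !moment_oy// -!ge0_integralZl//; try (by move=> r _; exact: mom0);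
    try (exact: measurable_moment); try (by rewrite lee_fin ltW).
  rewrite -!ge0_integralD//;
    try (by move=> r _; rewrite ?mule_ge0 ?lee_fin ?(ltW k0)//; exact: mom0);
    try (exact: measurable_moment); try (apply: measurable_funeM; exact: measurable_moment).
  apply: ge0_le_integral => //=.
  - by move=> r _; rewrite -EFinM -EFinD lee_fin addr_ge0 ?mulr_ge0 ?powR_ge0 ?(ltW k0).
  - apply: emeasurable_funD; first exact: measurable_moment.
    by apply: measurable_funeM; exact: measurable_moment.
  - apply: emeasurable_funD; first exact: measurable_moment.
    by apply: measurable_funeM; exact: measurable_moment.
  - move=> r; rewrite in_itv/= andbT => r0.
    by rewrite -!EFinM -!EFinD lee_fin pointwise.
(* The q-th moment of U may be infinite; that of the tent is finite, and is the
   one to be cancelled. *)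
have fin : (k%:E * moment q L)%E \is a fin_num by rewrite /moment integral_tent.
rewrite -(leeD2rE _ _ fin); apply: le_trans I.
by rewrite leeD2l// lee_wpmul2l ?lee_fin ?(ltW k0)// ltW.
Qed.

(** The tent with a = rbinom n q ^ (1/q) has q times its q-th moment equal to 1;
tent_moment_le applies to all smaller tents, and a is the limit. *)
Lemma berwald : (1 <= q%:E * moment q U)%E ->
  ((rbinom n q `^ (p / q))%:E <= (rbinom n p)%:E * (p%:E * moment p V))%E.
Proof.
move=> big; have Bq0 := rbinom_gt0 n q0; have Bp0 := rbinom_gt0 n p0.
pose A := rbinom n q `^ q^-1; have A0 : 0 < A by rewrite powR_gt0.
have step a : 0 < a -> a < A ->
    ((a `^ p)%:E <= (rbinom n p)%:E * (p%:E * moment p V))%E.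
  move=> a0 aA.
  have : (moment q (fun r => (tent a r ^+ n)%R) < moment q U)%E.
    rewrite /moment integral_tent// -/(moment q U).
    rewrite -(@lte_pmul2l _ q%:E)// -EFinM; apply: lt_le_trans big; rewrite lte_fin.
    have -> : q * (a `^ q / (q * rbinom n q)) = a `^ q / rbinom n q.
      by field; rewrite !gt_eqF.
    rewrite ltr_pdivrMr// mul1r.
    have -> : rbinom n q = A `^ q by rewrite /A -powRrM mulVf ?gt_eqF// powRr1// ltW.
    by apply: gt0_ltr_powR => //; rewrite nnegrE ltW.
  move=> /(tent_moment_le a0); rewrite {1}/moment integral_tent//.
  rewrite -(@lee_pmul2l _ p%:E) ?lte_fin// -(@lee_pmul2l _ (rbinom n p)%:E) ?lte_fin//.
  rewrite -!EFinM (_ : rbinom n p * _ = a `^ p)//.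
  by field; rewrite !gt_eqF.
have -> : rbinom n q `^ (p / q) = A `^ p by rewrite /A -powRrM mulrC.
have M0 : (0 <= moment p V)%E.
  by apply: integral_ge0 => r _; rewrite lee_fin mulr_ge0 ?powR_ge0.
move: step; case: (moment p V) M0 => [m||]//= M0 step; last first.
  by rewrite !gt0_muley ?lte_fin// leey.
rewrite -!EFinM lee_fin leNgt; apply/negP => lt.
set y := rbinom n p * (p * m) in lt step.
have y0 : 0 <= y by rewrite !mulr_ge0// ltW.
(* Otherwise take a tent whose p-th power lies halfway between y and A^p. *)
pose z := (y + A `^ p) / 2.
have z0 : 0 < z by rewrite divr_gt0// ltr_wpDl// powR_gt0.
have := step (z `^ p^-1); rewrite powR_gt0// => /(_ isT).
rewrite -powRrM mulVf ?gt_eqF// powRr1 ?(ltW z0)// => h.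
have : z `^ p^-1 < A.
  have -> : A = (A `^ p) `^ p^-1 by rewrite -powRrM divff ?gt_eqF// powRr1// ltW.
  by apply: gt0_ltr_powR; rewrite ?invr_gt0 ?nnegrE ?powR_ge0 ?(ltW z0)// /z; lra.
by move=> /h; rewrite -!EFinM lee_fin -/y /z; lra.
Qed.
End berwald.

(** * Ball bodies *)

Section ball_bodies.
Variables (R : realType) (n : nat).
Notation mu := (@lebesgue_measure R).
Notation vec := 'rV[R]_n.

Lemma covariogram_ge0 (L : set vec) x : 0 <= discrete_covariogram L x.
Proof. exact: ler0n. Qed.

Lemma ball_body_moment (p : R) (g : vec -> R) (x : vec) :
  ball_body p g x <-> ((g 0)%:E <= p%:E * moment p (fun r => g (r *: x)))%E.
Proof. by []. Qed.

Lemma moment_scale (p c : R) (g : vec -> R) (x : vec) : 0 < p -> 0 < c ->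
  measurable_fun setT (fun r : R => g (r *: x)) -> (forall y, 0 <= g y) ->
  ((c `^ p)%:E * moment p (fun r => g (r *: (c *: x))) =
   moment p (fun r => g (r *: x)))%E.
Proof.
move=> p0 c0 mg g0.
pose G (s : R) := (s `^ (p - 1) * g (s *: x))%:E.
have mG : measurable_fun setT G by exact: measurable_moment.
have G0 r : (0 <= G r)%E by rewrite lee_fin mulr_ge0 ?powR_ge0.
rewrite -[RHS](integral_scale c0 mG G0).
have -> : (\int[mu]_(r in `[0%R, +oo[) G (c * r)%R =
   \int[mu]_(r in `[0%R, +oo[)
     ((c `^ (p - 1))%:E * (r `^ (p - 1) * g (r *: (c *: x)))%:E))%E.
  apply: eq_integral => r; rewrite inE/= in_itv/= andbT => r0.
  by rewrite -EFinM /G powRM ?(ltW c0)// -mulrA scalerA (mulrC r c).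
have mgc : measurable_fun setT (fun r : R => g (r *: (c *: x))).
  rewrite (_ : (fun r => _) = (fun r => g (r *: x)) \o ( *%R c)); last first.
    by apply/funext => r /=; rewrite scalerA mulrC.
  by apply: measurableT_comp => //; exact: measurable_funM.
rewrite ge0_integralZl//=; last 3 first.
- exact: measurable_moment.
- by move=> r _; rewrite lee_fin mulr_ge0 ?powR_ge0.
- by rewrite lee_fin powR_ge0.
by rewrite muleA -EFinM mulr_powRB1 ?(ltW c0).
Qed.

(** The moment over [0, 1] alone gives c. *)
Lemma moment_const (p c : R) : 0 < p -> 0 <= c -> (c%:E <= p%:E * moment p (fun=> c))%E.
Proof.
move=> p0 c0.
have -> : c%:E = (p%:E * \int[mu]_(r in `[0%R, 1%R]) (r `^ (p - 1) * c)%:E)%E.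
  under eq_integral do rewrite mulrC EFinM.
  rewrite ge0_integralZl//=; last 2 first.
  - by apply/measurable_EFinP; apply: measurable_funTS; exact: measurable_powR.
  - by move=> r _; rewrite lee_fin powR_ge0.
  by rewrite integral_powR01// -!EFinM; congr EFin; field; rewrite gt_eqF.
rewrite lee_wpmul2l ?lee_fin ?(ltW p0)//; apply: ge0_subset_integral => //=.
- exact: measurable_moment.
- by move=> r _; rewrite lee_fin mulr_ge0 ?powR_ge0.
- by move=> r /=; rewrite !in_itv/= andbT => /andP[].
Qed.

(** Berwald's inequality for the covariograms normalized by g_K 0 = G_n K. *)
Lemma covariogram_moments (K : set vec) (p q : R) x : (0 < n)%N ->
  coord_bounded K -> segment_closed K -> K 0 -> 0 < p -> p < q ->
  ball_body q (discrete_covariogram K) x ->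
  ((discrete_covariogram K 0 * rbinom n q `^ (p / q))%:E <=
   (rbinom n p)%:E * (p%:E *
   moment p (fun r =>
     discrete_covariogram (minkowski_sum K (open_cube R n)) (r *: x))))%E.
Proof.
move=> n0 bK cK K0 p0 pq /ball_body_moment.
set g := discrete_covariogram K; set h := discrete_covariogram _ => hx.
have q0 : 0 < q by exact: lt_trans pq.
pose f0 := g 0.
have f0P : 0 < f0 by rewrite /f0 /g covariogram0 ltr0n lattice_count_gt0.
have iP : 0 < f0^-1 by rewrite invr_gt0.
have mg : measurable_fun setT (fun r : R => g (r *: x)) by exact: measurable_covariogram.
have mh : measurable_fun setT (fun r : R => h (r *: x)).
  apply: measurable_covariogram.
    exact: minkowski_coord_bounded bK (@open_cube_coord_bounded _ _).
  exact: minkowski_segment_closed cK (@open_cube_segment_closed _ _).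
have mZ (s : R) (f : R -> R) : measurable_fun setT f -> (forall r, 0 <= f r) ->
    moment s (fun r => f0^-1 * f r) = (f0^-1%:E * moment s f)%E.
  move=> mf fge0; rewrite /moment -ge0_integralZl//=.
  - by apply: eq_integral => r _; rewrite -EFinM mulrCA.
  - exact: measurable_moment.
  - by move=> r _; rewrite lee_fin mulr_ge0 ?powR_ge0.
  - by rewrite lee_fin ltW.
have gR r : 0 <= g (r *: x) by exact: covariogram_ge0.
have hR r : 0 <= h (r *: x) by exact: covariogram_ge0.
have := @berwald R n p q (fun r => f0^-1 * g (r *: x))
  (fun r => f0^-1 * h (r *: x)) n0 p0 pq.
rewrite !mZ// => B.
have : ((rbinom n q `^ (p / q))%:E <=
    (rbinom n p)%:E * (p%:E * (f0^-1%:E * moment p (fun r => h (r *: x)))))%E.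
  apply: B.
  - exact: measurable_funM.
  - exact: measurable_funM.
  - by move=> r; rewrite mulr_ge0 ?(ltW iP).
  - by move=> r; rewrite mulr_ge0 ?(ltW iP).
  - move=> r t u r0 t01 gr u0 un.
    have [a [a0 an]] := nonneg_root n0 (ltW f0P).
    rewrite ler_pdivlMl// -an -exprMn mulrDr mulrCA (mulrC a (1 - t)).
    apply: (@covariogram_concave R n K t r a (a * u) x) => //.
    - exact: mulr_ge0.
    - by move: gr; rewrite pmulr_rgt0.
    - by rewrite exprMn an un mulrA divff ?gt_eqF// mul1r.
  - rewrite muleCA -(@lee_pmul2l _ f0%:E) ?lte_fin// mule1 muleA -EFinM divff ?gt_eqF//.
    by rewrite mul1e.
rewrite -(@lee_pmul2l _ f0%:E) ?lte_fin// -EFinM => /le_trans; apply.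
rewrite (muleCA p%:E) (muleCA (rbinom n p)%:E) muleA -EFinM divff ?gt_eqF// mul1e.
by [].
Qed.

End ball_bodies.

Unset Implicit Arguments.

Theorem theorem6p2 (R : realType) (n : nat) (K : set 'rV[R]_n)
    (hK : convex_body K) (hK0 : K 0) (p q : R) (hp : 0 < p) (hpq : p < q) :
  dilate (gbinom n q `^ q^-1) (ball_body q (discrete_covariogram K))
  `<=`
  dilate (gbinom n p `^ p^-1 *
          ((lattice_count (minkowski_sum K (open_cube R n)))%:R /
           (lattice_count K)%:R) `^ p^-1)
    (ball_body p (discrete_covariogram (minkowski_sum K (open_cube R n)))).
Proof.
have [/compact_coord_bounded bK /convex_segment_closed cK _] := hK.
have q0 : 0 < q by exact: lt_trans hpq.
rewrite !gbinomE//.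
have Bp0 := rbinom_gt0 n hp; have Bq0 := rbinom_gt0 n q0.
set KC := minkowski_sum K (open_cube R n).
have bKC : coord_bounded KC.
  exact: minkowski_coord_bounded bK (@open_cube_coord_bounded _ _).
have cKC : segment_closed KC.
  exact: minkowski_segment_closed cK (@open_cube_segment_closed _ _).
have KC0 : KC 0.
  by exists 0 => //; exists 0; rewrite ?addr0// => i; rewrite mxE ltr01 ltrN10.
have f0 : 0 < (lattice_count K)%:R :> R by rewrite ltr0n lattice_count_gt0.
have h0 : 0 < (lattice_count KC)%:R :> R by rewrite ltr0n lattice_count_gt0.
set rho := (lattice_count KC)%:R / (lattice_count K)%:R.
have rho0 : 0 < rho by rewrite divr_gt0.
pose d := rbinom n p `^ p^-1 * rho `^ p^-1.
have d0 : 0 < d by rewrite mulr_gt0 ?powR_gt0.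
pose c := rbinom n q `^ q^-1 / d.
have c0 : 0 < c by rewrite divr_gt0 ?powR_gt0.
(* The scaling is forced: d (c x) must be the point rbinom n q ^ (1/q) x. *)
move=> _ [x hx <-]; exists (c *: x); last first.
  by rewrite scalerA -/d /c mulrC divfK// gt_eqF.
apply/ball_body_moment.
have [n0|n0] := posnP n.
  (* The space is a point, so the covariogram is constant along the ray. *)
  rewrite (_ : (fun r => _) = fun=> discrete_covariogram KC 0); last first.
    by apply/funext => r; congr (discrete_covariogram KC _); subst n; rewrite !thinmx0.
  by apply: moment_const => //; exact: covariogram_ge0.
have := covariogram_moments n0 bK cK hK0 hp hpq hx; rewrite -/KC.
rewrite -(moment_scale hp c0); last 2 first.
- exact: measurable_covariogram.
- exact: covariogram_ge0.
set M := moment _ _; rewrite !covariogram0.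
(* rho is the ratio of the two values at 0, so that h 0 * c^p is f0 times the
   constant of the moment inequality. *)
have cp : c `^ p = rbinom n q `^ (p / q) / (rbinom n p * rho).
  rewrite /c powRM ?powR_ge0 ?invr_ge0 ?(ltW d0)//.
  rewrite -powRrM (mulrC q^-1); congr (_ * _).
  rewrite -(powR_inv1 (ltW d0)) -powRrM mulN1r powRN; congr (_^-1).
  by rewrite /d powRM ?powR_ge0// -!powRrM mulVf ?gt_eqF// !powRr1// ltW.
move=> h.
have cp0 : 0 < rbinom n p * c `^ p by rewrite mulr_gt0 ?powR_gt0.
rewrite -(@lee_pmul2l _ (rbinom n p * c `^ p)%:E) ?lte_fin//.
rewrite [leRHS](_ : _ = (rbinom n p)%:E * (p%:E * ((c `^ p)%:E * M)))%E; last first.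
  by rewrite EFinM -muleA (muleCA (c `^ p)%:E).
apply: le_trans h; rewrite -EFinM lee_fin cp /rho le_eqVlt; apply/orP; left; apply/eqP.
by field; rewrite !gt_eqF.
Qed.
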